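(* Let $(M,\omega)$ be the twistor space of a hyperbolic $2n$-fold, equipped with the symplectic form $\omega$ described in the context. Then $(M,\omega)$ admits a compatible almost complex structure whose Chern-Ricci form satisfies $\rho=(2n-4)\omega$.
   Context: $SO(2n,1)\subset GL(2n+1,\mathbf R)$ denotes the identity component of the group of linear transformations preserving $q(v)=v_1^2+\dots+v_{2n}^2-v_{2n+1}^2$; hyperbolic space is $H^{2n}=SO(2n,1)/SO(2n)$. A hyperbolic $2n$-fold is a complete Riemannian $2n$-fold of constant sectional curvature $-1$, of the form $\Gamma\backslash H^{2n}$ with $\Gamma\subset SO(2n,1)$ a torsion-free discrete subgroup. Its twistor space is the space of all orthogonal, orientation-compatible complex structures on its tangent spaces; it is $\Gamma\backslash SO(2n,1)/U(n)$, where $U(n)\subset SO(2n)$ is the subgroup commuting with the standard complex structure $J_0$ of $\mathbf R^{2n}$ (orientation conventions being such that $J_0$ is orientation-compatible). Symplectic form. The Lie algebra $\mathfrak g$ of $SO(2n,1)$ consists of the matrices $X=\begin{pmatrix} A & u \\ u^t & 0 \end{pmatrix}$ with $u\in\mathbf R^{2n}$, $A\in\mathfrak o(2n)$. The subspace $\mathfrak m\subset\mathfrak g$ of those $X$ with $AJ_0+J_0A=0$ is a $U(n)$-invariant complement to $\mathfrak u(n)$, identified with the tangent space of $SO(2n,1)/U(n)$ at the base point. The form $\omega$ is induced on $\Gamma\backslash SO(2n,1)/U(n)$ by the $SO(2n,1)$-invariant symplectic form on $SO(2n,1)/U(n)$ which at the base point is $$\sigma(X,Y)=\langle J_0u,v\rangle+\mathrm{tr}(J_0AC),\qquad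 X=\begin{pmatrix} A & u \\ u^t & 0 \end{pmatrix},\ Y=\begin{pmatrix} C & v \\ v^t & 0 \end{pmatrix}\in\mathfrak m .$$ Chern-Ricci form. A compatible almost complex structure $J$ on $(M,\omega)$ satisfies $J^2=-\mathrm{id}$, $\omega(JX,JY)=\omega(X,Y)$, $\omega(X,JX)>0$ for nonzero $X$; put $g(X,Y)=\omega(X,JY)$ and $4N(X,Y)=[JX,JY]-J[JX,Y]-J[X,JY]-[X,Y]$. The Chern connection $\nabla$ is the unique connection preserving $g$ with torsion $N$, $R(X,Y)=\nabla_X\nabla_Y-\nabla_Y\nabla_X-\nabla_{[X,Y]}$, and $\rho(X,Y)=\mathrm{tr}(JR(X,Y))$ (real trace). *)

(* Defs.v *)
(* Tensor calculus on M = Gamma \ SO(2n,1) / U(n).  Left translation by g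
   identifies the tangent space of SO(2n,1)/U(n) at g U(n) with m, the class of
   (g, X) being that of (g k, k^-1 X k) for k in U(n).  Hence
   - functions on M are the functions on SO(2n,1) that are invariant under
     Gamma on the left and U(n) on the right;
   - vector fields on M are the maps from SO(2n,1) to m that are
     Gamma-invariant on the left and U(n)-equivariant on the right; likewise
     for endomorphism fields and forms.
   All of these are total functions on matrices whose values off SO(2n,1) are
   junk: every condition below only concerns values on SO(2n,1). *)
From HB Require Import structures.
From mathcomp Require Import all_boot all_order all_algebra.
From mathcomp Require Import all_classical all_reals all_analysis.

Set Implicit Arguments.
Unset Strict Implicit.
Unset Printing Implicit Defensive.

Import Order.TTheory GRing.Theory Num.Theory.
Import numFieldNormedType.Exports.

Local Open Scope classical_set_scope.
Local Open Scope ring_scope.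

(* Matrices of size 2n+1 act on column vectors; R^{2n} is written R^n (+) R^n. *)
Notation mat R n := 'M[R]_(n + n + 1).

Definition J0 (R : realType) (n : nat) : 'M[R]_(n + n) :=
  block_mx 0 (- 1%:M) 1%:M 0.

Definition quad (R : realType) (n : nat) (v : 'cV[R]_(n + n + 1)) : R :=
  \sum_(i < n + n) v (lshift 1 i) 0 ^+ 2 - v (rshift (n + n) 0) 0 ^+ 2.

Definition SO (R : realType) (n : nat) : set (mat R n) :=
  connected_component [set g : mat R n | forall v, quad (g *m v) = quad v] 1%:M.

(* The matrices diag(k0, 1) in SO(2n,1) are exactly those with k0 in SO(2n). *)
Definition U (R : realType) (n : nat) : set (mat R n) :=
  [set k | SO k /\ exists2 k0 : 'M[R]_(n + n),
    k = block_mx k0 0 0 1%:M & k0 *m J0 R n = J0 R n *m k0].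

Record torsion_free_discrete_subgroup (R : realType) (n : nat)
    (Gamma : set (mat R n)) : Prop := {
  Gamma_sub : Gamma `<=` @SO R n;
  Gamma_one : Gamma 1%:M;
  Gamma_mul : forall a b, Gamma a -> Gamma b -> Gamma (a *m b);
  Gamma_inv : forall a, Gamma a -> Gamma (invmx a);
  Gamma_discrete : Gamma `<=` isolated Gamma;
  Gamma_torsion_free :
    forall a k, Gamma a -> (0 < k)%N -> a ^+ k = 1%:M -> a = 1%:M }.

Definition m_space (R : realType) (n : nat) : set (mat R n) :=
  [set X | exists (A : 'M[R]_(n + n)) (u : 'cV[R]_(n + n)),
    [/\ A^T = - A, A *m J0 R n + J0 R n *m A = 0 & X = block_mx A u u^T 0]].

Definition sigma (R : realType) (n : nat) (X Y : mat R n) : R :=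
  let A := ulsubmx X in let u := ursubmx X in
  let C := ulsubmx Y in let v := ursubmx Y in
  \sum_i (J0 R n *m u) i 0 * v i 0 + \tr (J0 R n *m A *m C).

Fixpoint Ck (R : realType) (V W : normedModType R) (k : nat) (F : V -> W) :
    Prop :=
  if k is k'.+1 then
    (forall x, differentiable F x) /\ forall v, Ck k' (fun x => 'D_v F x)
  else continuous F.

(* SO(2n,1) is an embedded submanifold of the space of all matrices: smooth
   functions on it are those that extend smoothly near each point. *)
Definition smooth_ext (R : realType) (n : nat) (W : normedModType R)
    (f : mat R n -> W) (g : mat R n) (F : mat R n -> W) : Prop :=
  (forall k, Ck k F) /\ \forall h \near g, SO h -> f h = F h.

Definition smooth (R : realType) (n : nat) (W : normedModType R)
    (f : mat R n -> W) : Prop :=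
  forall g, SO g -> exists F, smooth_ext f g F.

(* Derivative of f at g along the tangent vector g X of SO(2n,1), X in the Lie
   algebra; it does not depend on the chosen extension. *)
Definition der (R : realType) (n : nat) (W : normedModType R)
    (f : mat R n -> W) (g X : mat R n) : W :=
  'D_(g *m X) (xget f [set F | smooth_ext f g F]) g.

Record invariant_function (R : realType) (n : nat) (Gamma : set (mat R n))
    (f : mat R n -> R) : Prop := {
  fun_smooth : smooth f;
  fun_left : forall a g, Gamma a -> SO g -> f (a *m g) = f g;
  fun_right : forall g k, SO g -> U k -> f (g *m k) = f g }.

Record vector_field (R : realType) (n : nat) (Gamma : set (mat R n))
    (x : mat R n -> mat R n) : Prop := {
  vf_smooth : smooth x;
  vf_m : forall g, SO g -> m_space (x g);
  vf_left : forall a g, Gamma a -> SO g -> x (a *m g) = x g;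
  vf_right : forall g k, SO g -> U k -> x (g *m k) = invmx k *m x g *m k }.

(* [x, y] is the unique vector field with [x, y] f = x (y f) - y (x f).  As M is
   locally SO(2n,1)/U(n), this is tested on functions f on SO(2n,1)/U(n), the
   case Gamma = 1. *)
Definition lie_bracket (R : realType) (n : nat) (Gamma : set (mat R n))
    (x y : mat R n -> mat R n) : mat R n -> mat R n :=
  xget (fun=> 0) [set z | vector_field Gamma z /\
    forall f, invariant_function [set 1%:M] f -> forall g, SO g ->
      der f g (z g) = der (fun h => der f h (y h)) g (x g)
                      - der (fun h => der f h (x h)) g (y g)].

(* The SO(2n,1)-invariant form has constant coefficients in the left
   trivialization. *)
Definition omega (R : realType) (n : nat) (g X Y : mat R n) : R := sigma X Y.

(* Only the restriction of J g to m matters. *)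
Record compatible_acs (R : realType) (n : nat) (Gamma : set (mat R n))
    (J : mat R n -> 'End(mat R n)) : Prop := {
  acs_smooth : forall X, m_space X -> smooth (fun g => J g X);
  acs_m : forall g X, SO g -> m_space X -> m_space (J g X);
  acs_left : forall a g X, Gamma a -> SO g -> m_space X ->
    J (a *m g) X = J g X;
  acs_right : forall g k X, SO g -> U k -> m_space X ->
    J (g *m k) X = invmx k *m J g (k *m X *m invmx k) *m k;
  acs_square : forall g X, SO g -> m_space X -> J g (J g X) = - X;
  acs_omega : forall g X Y, SO g -> m_space X -> m_space Y ->
    omega g (J g X) (J g Y) = omega g X Y;
  acs_pos : forall g X, SO g -> m_space X -> X != 0 ->
    0 < omega g X (J g X) }.

Definition metric (R : realType) (n : nat) (J : mat R n -> 'End(mat R n))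
    (g X Y : mat R n) : R := omega g X (J g Y).

Definition app (R : realType) (n : nat) (J : mat R n -> 'End(mat R n))
    (x : mat R n -> mat R n) : mat R n -> mat R n := fun g => J g (x g).

Definition nijenhuis (R : realType) (n : nat) (Gamma : set (mat R n))
    (J : mat R n -> 'End(mat R n)) (x y : mat R n -> mat R n) :
    mat R n -> mat R n := fun g =>
  4^-1 *: (lie_bracket Gamma (app J x) (app J y) g
           - J g (lie_bracket Gamma (app J x) y g)
           - J g (lie_bracket Gamma x (app J y) g)
           - lie_bracket Gamma x y g).

Record connection (R : realType) (n : nat) (Gamma : set (mat R n))
    (nabla : (mat R n -> mat R n) -> (mat R n -> mat R n) ->
             mat R n -> mat R n) : Prop := {
  conn_vf : forall x y, vector_field Gamma x -> vector_field Gamma y ->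
    vector_field Gamma (nabla x y);
  conn_linear : forall f x x' y, invariant_function Gamma f ->
    vector_field Gamma x -> vector_field Gamma x' -> vector_field Gamma y ->
    forall g, SO g ->
    nabla (fun h => f h *: x h + x' h) y g = f g *: nabla x y g + nabla x' y g;
  conn_add : forall x y y', vector_field Gamma x ->
    vector_field Gamma y -> vector_field Gamma y' ->
    forall g, SO g ->
    nabla x (fun h => y h + y' h) g = nabla x y g + nabla x y' g;
  conn_leibniz : forall f x y, invariant_function Gamma f ->
    vector_field Gamma x -> vector_field Gamma y ->
    forall g, SO g ->
    nabla x (fun h => f h *: y h) g
      = der f g (x g) *: y g + f g *: nabla x y g }.

Record chern_connection (R : realType) (n : nat) (Gamma : set (mat R n))
    (J : mat R n -> 'End(mat R n))
    (nabla : (mat R n -> mat R n) -> (mat R n -> mat R n) ->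
             mat R n -> mat R n) : Prop := {
  chern_conn : connection Gamma nabla;
  chern_metric : forall x y z, vector_field Gamma x ->
    vector_field Gamma y -> vector_field Gamma z ->
    forall g, SO g ->
    der (fun h => metric J h (y h) (z h)) g (x g)
      = metric J g (nabla x y g) (z g) + metric J g (y g) (nabla x z g);
  chern_torsion : forall x y, vector_field Gamma x -> vector_field Gamma y ->
    forall g, SO g ->
    nabla x y g - nabla y x g - lie_bracket Gamma x y g
      = nijenhuis Gamma J x y g }.

Definition curvature (R : realType) (n : nat) (Gamma : set (mat R n))
    (nabla : (mat R n -> mat R n) -> (mat R n -> mat R n) ->
             mat R n -> mat R n) (x y z : mat R n -> mat R n) :
    mat R n -> mat R n := fun g =>
  nabla x (nabla y z) g - nabla y (nabla x z) g
  - nabla (lie_bracket Gamma x y) z g.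

(* t is the trace of the endomorphism of m induced by S, in some basis. *)
Definition is_trace_m (R : realType) (n : nat) (S : 'End(mat R n)) (t : R) :
    Prop :=
  (forall X, m_space X -> m_space (S X)) /\
  exists d (b : d.-tuple (mat R n)),
    [/\ free b, forall X, m_space X <-> X \in <<b>>%VS
      & t = \sum_(i < d) coord b i (S (tnth b i))].

(* The metric connection with given torsion is unique, and so is the restriction
   to m of S, the value at g of the endomorphism field J R(x, y), because the
   values at g of vector fields on M fill m. *)
Definition is_chern_ricci (R : realType) (n : nat) (Gamma : set (mat R n))
    (J : mat R n -> 'End(mat R n)) (rho : mat R n -> mat R n -> mat R n -> R) :
    Prop :=
  exists2 nabla, chern_connection Gamma J nabla &
  forall x y, vector_field Gamma x -> vector_field Gamma y ->
  forall g, SO g ->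
  exists2 S : 'End(mat R n),
    forall z, vector_field Gamma z ->
      S (z g) = J g (curvature Gamma nabla x y z g)
  & is_trace_m S (rho g (x g) (y g)).

(* Main.v *)
(* Take on SO(2n,1)/U(n) the invariant almost complex structure
   J (A, u) = (A J0, J0 u).  Its Nijenhuis tensor is N(X, Y) = - [X, Y]_m, which
   is exactly the torsion of the canonical connection of the reductive space,
   i.e. differentiation in the left trivialization.  This connection preserves
   every invariant tensor, so it is the Chern connection.  Its curvature is
   R(X, Y) = - ad [X, Y]_k, and for W = diag(w, 0) in u(n) one has
   tr_m (J ad W) = - (n - 2) tr (J0 w), while tr (J0 [X, Y]_k) = 2 sigma(X, Y). *)

(* A vector field on M is an m-valued function on the group, but the commutator of two such
   derivations has a component W = [X, Y]_k along the fibres of the projection from SO(2n,1). One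
   commutator formula, [der_comm_vf], keeps both components. On a scalar function lifted from the
   quotient the fibre term vanishes, and the formula identifies the Lie bracket; on an equivariant
   field the fibre term is - ad W, and the same formula gives the curvature. The equality N = -
   [X, Y]_m holds because the m-part of the bracket is conjugate linear in each argument, so that
   the four terms of 4 N coincide. In - tr_m (J ad W) the skew block of m contributes (n - 1) tr (J0
   w) and the vector block - tr (J0 w). Most of the length goes into making derivatives legitimate:
   [der] rests on a chosen extension and [lie_bracket] on a chosen field. Independence of the
   extension comes from differentiating along curves that stay in the group; the value of the
   bracket is pinned down by explicit invariant functions. *)
Require Import Defs.
From HB Require Import structures.
From mathcomp Require Import all_boot all_order all_algebra.
From mathcomp Require Import all_classical all_reals all_analysis.
From mathcomp Require Import ring.
Import Order.TTheory GRing.Theory Num.Theory.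
Import numFieldNormedType.Exports.
Local Open Scope classical_set_scope.
Local Open Scope ring_scope.

Set Implicit Arguments.
Unset Strict Implicit.
Unset Printing Implicit Defensive.

(** * Smooth maps on normed modules *)

Section Calculus.
Variable R : realType.
Implicit Types U V W : normedModType R.

Lemma differentiable_linear_comp U V W (f : V -> W) (F : U -> V) x :
  linear f -> continuous f -> differentiable F x ->
  differentiable (f \o F) x /\ forall v, 'D_v (f \o F) x = f ('D_v F x).
Proof.
move=> flin fcont dF.
pose L : {linear V -> W} := HB.pack f (GRing.isLinear.Build _ _ _ _ _ flin).
have dL y : differentiable L y by exact: linear_differentiable.
have dfF : differentiable (L \o F) x by exact: differentiable_comp.
split=> // v.
rewrite -[f]/(L : V -> W) deriveE// diff_comp// deriveE//=.
have dLE : 'd L (F x) = L :> (V -> W) by exact: diff_lin.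
by rewrite dLE.
Qed.

(** The product rule. Bilinearity is a hypothesis on a plain function, so that matrix products,
    scaling and the metric can all be substituted for [B]. *)
Lemma differentiable_bilinear_comp U V V' W (B : V -> V' -> W)
    (F : U -> V) (G : U -> V') x :
  (forall u, linear (B u)) -> (forall v, linear (B ^~ v)) ->
  continuous (fun p : V * V' => B p.1 p.2) ->
  differentiable F x -> differentiable G x ->
  differentiable (fun y => B (F y) (G y)) x /\
  forall v, 'D_v (fun y => B (F y) (G y)) x
    = B ('D_v F x) (G x) + B (F x) ('D_v G x).
Proof.
move=> Br Bl Bc dF dG.
have Bbil : bilinear_for
    (GRing.Scale.Law.clone _ _ *:%R _) (GRing.Scale.Law.clone _ _ *:%R _) B.
  by split=> [v|u] a y z /=; rewrite ?Bl ?Br.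
pose L : {bilinear V -> V' -> W} :=
  HB.pack B (bilinear_isBilinear.Build R V V' W _ _ B Bbil).
have dL p : differentiable (fun q : V * V' => L q.1 q.2) p.
  exact: differentiable_bilin.
have dFG : differentiable (fun y => (F y, G y)) x by exact: differentiable_pair.
have dLFG : differentiable ((fun q => L q.1 q.2) \o (fun y => (F y, G y))) x.
  exact: differentiable_comp.
split=> // v.
have dLE : 'd (fun q : V * V' => L q.1 q.2) (F x, G x)
    = (fun q => L (F x) q.2 + L q.1 (G x)) :> (V * V' -> W).
  exact: diff_bilin.
have dFGE : 'd (fun y => (F y, G y)) x = (fun y => ('d F x y, 'd G x y))
    :> (U -> V * V') by exact: diff_pair.
by rewrite (deriveE _ dLFG) diff_comp//= dLE dFGE/= addrC !deriveE.
Qed.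

Lemma Ck_S V W k (F : V -> W) : Ck k.+1 F -> Ck k F.
Proof.
elim: k F => [|k IH] F; first by case=> dF _ x; exact: differentiable_continuous.
by case=> dF DF; split=> // v; exact/IH/DF.
Qed.

Lemma Ck_cst V W k (a : W) : Ck k (cst a : V -> W).
Proof.
elim: k a => [|k IH] a; first by move=> x; exact: cvg_cst.
split=> [x|v]; first exact: differentiable_cst.
have -> : (fun x => 'D_v (cst a : V -> W) x) = cst 0.
  by apply/funext => x; rewrite derive_cst.
exact: IH.
Qed.

Lemma Ck_comp_linear U V W (f : V -> W) k (F : U -> V) :
  linear f -> continuous f -> Ck k F -> Ck k (f \o F).
Proof.
move=> fl fc; elim: k F => [|k IH] F; 
  first by move=> Fc x; apply: continuous_comp; [exact: Fc|exact: fc].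
case=> dF DF; split=> [x|v].
  exact: (differentiable_linear_comp fl fc (dF x)).1.
have -> : (fun x => 'D_v (f \o F) x) = f \o (fun x => 'D_v F x).
  by apply/funext => x; rewrite (differentiable_linear_comp fl fc (dF x)).2.
exact/IH/DF.
Qed.

Lemma Ck_linear V W k (f : V -> W) : linear f -> continuous f -> Ck k f.
Proof.
move=> fl fc.
have Ck_id : Ck k (id : V -> V).
  case: k => [|k]; first by move=> x; exact: cvg_id.
  split=> [x|v]; first exact: ex_diff.
  rewrite (_ : (fun x => 'D_v id x) = cst v); first exact: Ck_cst.
  by apply/funext => x; rewrite derive_id.
exact: (Ck_comp_linear fl fc Ck_id).
Qed.

Lemma CkD V W k (F G : V -> W) : Ck k F -> Ck k G -> Ck k (fun x => F x + G x).
Proof.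
elim: k F G => [|k IH] F G; first by move=> Fc Gc x; exact: cvgD (Fc x) (Gc x).
move=> [dF DF] [dG DG]; split=> [x|v]; first exact: differentiableD.
have -> : (fun x => 'D_v (fun x => F x + G x) x)
    = (fun x => 'D_v F x + 'D_v G x).
  by apply/funext => x; rewrite deriveD//; exact: diff_derivable.
by apply: IH; [exact: DF|exact: DG].
Qed.

Lemma Ck_bilinear U V V' W (B : V -> V' -> W) k (F : U -> V) (G : U -> V') :
  (forall u, linear (B u)) -> (forall v, linear (B ^~ v)) ->
  continuous (fun p : V * V' => B p.1 p.2) ->
  Ck k F -> Ck k G -> Ck k (fun x => B (F x) (G x)).
Proof.
move=> Br Bl Bc; elim: k F G => [|k IH] F G.
  move=> Fc Gc x.
  by apply: (continuous2_cvg); [exact: Bc (F x, G x)|exact: Fc|exact: Gc].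
move=> CF CG; have [[dF DF] [dG DG]] := (CF, CG); split=> [x|v].
  exact: (differentiable_bilinear_comp Br Bl Bc (dF x) (dG x)).1.
have -> : (fun x => 'D_v (fun x => B (F x) (G x)) x)
    = (fun x => B ('D_v F x) (G x) + B (F x) ('D_v G x)).
  apply/funext => x.
  by rewrite (differentiable_bilinear_comp Br Bl Bc (dF x) (dG x)).2.
by apply: CkD; apply: IH; [exact: DF|exact: Ck_S|exact: Ck_S|exact: DG].
Qed.

Lemma Ck_sum V W k (I : Type) (r : seq I) (F : I -> V -> W) :
  (forall i, Ck k (F i)) -> Ck k (fun x => \sum_(i <- r) F i x).
Proof.
move=> CF; elim: r => [|i r IH].
  under eq_fun do rewrite big_nil; exact: Ck_cst.
by under eq_fun do rewrite big_cons; exact: CkD.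
Qed.

Lemma sum_continuous (T : topologicalType) W (I : Type) (r : seq I)
    (F : I -> T -> W) :
  (forall i, continuous (F i)) -> continuous (fun x => \sum_(i <- r) F i x).
Proof.
by move=> Fc; apply: continuous_big; [exact: add_continuous|move=> i _; exact: Fc].
Qed.

(** Finite dimension enters here: in the basis [delta_mx] the map is a finite sum of coordinates
    times fixed vectors. *)
Lemma matrix_linear_continuous p q W (f : 'M[R]_(p, q) -> W) :
  linear f -> continuous f.
Proof.
move=> fl.
pose L : {linear 'M[R]_(p, q) -> W} :=
  HB.pack f (GRing.isLinear.Build _ _ _ _ _ fl).
have -> : f = (fun M => \sum_i \sum_j M i j *: f (delta_mx i j)).
  apply/funext => M; rewrite {1}(matrix_sum_delta M) -[f]/(L : _ -> _).
  rewrite linear_sum; apply: eq_bigr => i _.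
  by rewrite linear_sum; apply: eq_bigr => j _; rewrite linearZ.
apply: sum_continuous => i; apply: sum_continuous => j M.
by apply: continuousZr_tmp; exact: coord_continuous.
Qed.

(** Only the first argument is expanded in a basis; for the second, whose space is arbitrary,
    continuity has to be assumed. *)
Lemma matrix_bilinear_continuous p q V W (B : 'M[R]_(p, q) -> V -> W) :
  (forall u, linear (B u)) -> (forall u, continuous (B u)) ->
  (forall v, linear (B ^~ v)) ->
  continuous (fun x : 'M[R]_(p, q) * V => B x.1 x.2).
Proof.
move=> Br Bc Bl.
have -> : (fun x : 'M[R]_(p, q) * V => B x.1 x.2)
    = (fun x => \sum_i \sum_j x.1 i j *: B (delta_mx i j) x.2).
  apply/funext => -[M v] /=.
  pose L : {linear 'M[R]_(p, q) -> W} :=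
    HB.pack (B ^~ v) (GRing.isLinear.Build _ _ _ _ _ (Bl v)).
  rewrite {1}(matrix_sum_delta M) -[B _ _]/(L _).
  rewrite linear_sum; apply: eq_bigr => i _.
  by rewrite linear_sum; apply: eq_bigr => j _; rewrite linearZ.
apply: sum_continuous => i; apply: sum_continuous => j x.
apply: continuousZ.
  apply: (@continuous_comp _ _ _ fst (fun M : 'M[R]_(p, q) => M i j)).
    exact: cvg_fst.
  exact: coord_continuous.
apply: (@continuous_comp _ _ _ snd (B (delta_mx i j))); first exact: cvg_snd.
exact: Bc.
Qed.

End Calculus.

(** * Symmetry of second derivatives *)

Section SecondDerivative.
Variable R : realType.
Implicit Types V W : normedModType R.

Lemma derive1_comp_curve V W (F : V -> W) (c : R -> V) (t : R) (w : V) :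
  is_derive t 1 c w -> differentiable F (c t) ->
  is_derive t 1 (F \o c) ('D_w F (c t)).
Proof.
move=> [dc <-] dF.
have dc' : differentiable c t by exact/derivable1_diffP.
have dFc : differentiable (F \o c) t by exact: differentiable_comp.
apply: DeriveDef; first exact: diff_derivable.
by rewrite deriveE// diff_comp//= !deriveE.
Qed.

Lemma is_derive_line V (y u : V) (t : R) :
  is_derive t 1 (fun s : R => y + s *: u) u.
Proof.
have dl : differentiable (fun s : R => s *: u) t by [].
have ds : derivable (fun s : R => s *: u) t 1 by exact: diff_derivable.
have -> : (fun s : R => y + s *: u) = cst y + (fun s : R => s *: u) by [].
have := is_deriveD (is_derive_cst y t 1) (derivableP ds).
by rewrite add0r deriveE// diff_val scale1r.
Qed.

Lemma directional_MVT V (F : V -> R) (y u : V) (h : R) :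
  (forall x, differentiable F x) -> 0 < h ->
  exists2 s, 0 < s < h & F (y + h *: u) - F y = 'D_u F (y + s *: u) * h.
Proof.
move=> dF h0.
pose c s := y + s *: u.
have dFc s : is_derive s (1 : R) (F \o c) ('D_u F (c s)).
  exact: (@derive1_comp_curve _ _ _ _ _ _ (is_derive_line y u s)).
have [|s] := MVT h0 (fun s _ => dFc s).
  apply: derivable_within_continuous => s _.
  by have [] := dFc s.
rewrite in_itv/= => sh; rewrite /c /= scale0r addr0 subr0 => ->.
by exists s.
Qed.

(** The mean value theorem is applied along u to the increment of [F] in direction v, then along v
    to ['D_u F]. The left-hand side is symmetric in u and v. *)
Lemma second_difference V (F : V -> R) (x u v : V) (h : R) :
  Ck 2 F -> 0 < h ->
  exists s r, [/\ 0 < s < h, 0 < r < h &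
    F (x + h *: u + h *: v) - F (x + h *: u) - F (x + h *: v) + F x
    = 'D_v (fun y => 'D_u F y) (x + s *: u + r *: v) * h ^+ 2].
Proof.
move=> [dF DF] h0.
pose G y := F (y + h *: v) - F y.
have dsh (y : V) : differentiable (fun z => z + h *: v) y.
  by apply: differentiableD.
have dFsh (y : V) : differentiable (F \o (fun z => z + h *: v)) y.
  exact: differentiable_comp.
have dG y : differentiable G y by exact: differentiableB.
have [s sh Gs] := directional_MVT x u dG h0.
have [r rh Fr] := directional_MVT (x + s *: u) v (DF u).1 h0.
exists s, r; split=> //.
have <- : G (x + h *: u) - G x
  = F (x + h *: u + h *: v) - F (x + h *: u) - F (x + h *: v) + F x.
  by rewrite /G opprB addrA addrAC.
rewrite Gs expr2 mulrA -Fr; congr (_ * _).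
have shD z : 'D_u (F \o (fun z => z + h *: v)) z = 'D_u F (z + h *: v).
  rewrite /derive; set f1 := fun _ => _; set f2 := fun _ => _.
  by suff -> : f1 = f2; last by apply/funext => t; rewrite /f1 /f2 /= addrA.
have -> : G = (F \o (fun z => z + h *: v)) - F by [].
by rewrite deriveB ?shD//; exact: diff_derivable.
Qed.

(** Both mixed derivatives, taken at suitable points of a small parallelogram at x, equal the same
    second difference quotient. Their continuity then bounds the gap at x by any e > 0. *)
Lemma derive_comm_real V (F : V -> R) (x u v : V) : Ck 2 F ->
  'D_u (fun y => 'D_v F y) x = 'D_v (fun y => 'D_u F y) x.
Proof.
move=> C2.
pose A := fun y => 'D_v (fun y => 'D_u F y) y.
pose B := fun y => 'D_u (fun y => 'D_v F y) y.
suff near_eq e : 0 < e -> `|A x - B x| < e.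
  apply/eqP; rewrite eq_sym -subr_eq0 -normr_le0 leNgt; apply/negP.
  by move=> /near_eq; rewrite ltxx.
move=> e0.
have cA : continuous A by exact: (C2.2 u).2.
have cB : continuous B by exact: (C2.2 v).2.
have param (a b : V) : (fun p : R * R => x + p.1 *: a + p.2 *: b) q
    @[q --> (0, 0)] --> x.
  rewrite -[X in _ --> X](_ : x + 0 *: a + 0 *: b = x); last first.
    by rewrite !scale0r !addr0.
  apply: cvgD; first apply: cvgD; first exact: cvg_cst.
    by apply: cvgZr_tmp; exact: cvg_fst.
  by apply: cvgZr_tmp; exact: cvg_snd.
have box (C : V -> R) a b : continuous C -> exists2 d, 0 < d &
    forall s r, 0 < s < d -> 0 < r < d ->
    `|C x - C (x + s *: a + r *: b)| < e / 2.
  move=> cC; have := cvg_comp _ _ (param a b) (cC x).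
  move=> /cvgrPdist_lt/(_ (e / 2)).
  rewrite divr_gt0// => /(_ isT).
  move=> /nbhs_ballP[d /= d0 Hd]; exists d => // s r /andP[s0 sd] /andP[r0 rd].
  apply: (Hd (s, r)); split; rewrite /= /ball/= sub0r normrN gtr0_norm//.
have [d1 d10 H1] := box A u v cA.
have [d2 d20 H2] := box B v u cB.
pose h := Num.min d1 d2.
have h0 : 0 < h by rewrite lt_min d10.
have [s1 [r1 [s1h r1h E1]]] := second_difference x u v C2 h0.
have [s2 [r2 [s2h r2h E2]]] := second_difference x v u C2 h0.
have lt_d s : 0 < s < h -> 0 < s < d1 /\ 0 < s < d2.
  by case/andP=> s0; rewrite lt_min => /andP[-> ->]; rewrite s0.
(* The two second differences differ only in the order of their terms, and h ^+ 2 cancels. *)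
have EAB : A (x + s1 *: u + r1 *: v) = B (x + s2 *: v + r2 *: u).
  apply: (@mulIf _ (h ^+ 2)); first by rewrite expf_neq0// gt_eqF.
  apply: etrans (esym E1) (etrans _ E2).
  by rewrite (addrAC x (h *: v)); congr (_ + _); exact: addrAC.
have := H2 _ _ (lt_d _ s2h).2 (lt_d _ r2h).2.
have := H1 _ _ (lt_d _ s1h).1 (lt_d _ r1h).1.
rewrite EAB; move: (A x) (B x) (B _) => a b p ap bp.
rewrite [ltRHS]splitr; apply: le_lt_trans (ltrD ap bp).
by rewrite (distrC b p); exact: ler_distD.
Qed.

(* Reduces vector-valued maps to scalar ones, so that the mean value theorem
   suffices. *)
Definition separated_by_forms W :=
  forall w : W, (forall l : W -> R, linear l -> continuous l -> l w = 0) ->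
  w = 0.

Lemma real_separated_by_forms : separated_by_forms R.
Proof.
move=> w /(_ idfun); apply=> //.
by move=> x; exact: cvg_id.
Qed.

Lemma matrix_separated_by_forms p q : separated_by_forms 'M[R]_(p, q).
Proof.
move=> w w0; apply/matrixP => i j; rewrite [RHS]mxE.
apply: (w0 (fun M : 'M[R]_(p, q) => M i j)); last exact: coord_continuous.
by move=> a A B; rewrite !mxE.
Qed.

Lemma derive_comm V W (F : V -> W) (x u v : V) : separated_by_forms W ->
  Ck 2 F -> 'D_u (fun y => 'D_v F y) x = 'D_v (fun y => 'D_u F y) x.
Proof.
move=> sepW C2; apply/eqP; rewrite -subr_eq0; apply/eqP/sepW => l ll lc.
pose L : {linear W -> R} := HB.pack l (GRing.isLinear.Build _ _ _ _ _ ll).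
have lB a b : l (a - b) = l a - l b by exact: (linearB L).
have DlF w : (fun y => 'D_w (l \o F) y) = l \o (fun y => 'D_w F y).
  by apply/funext => y; rewrite (differentiable_linear_comp ll lc (C2.1 y)).2.
have DDlF w z : 'D_w (fun y => 'D_z (l \o F) y) x
    = l ('D_w (fun y => 'D_z F y) x).
  by rewrite DlF (differentiable_linear_comp ll lc ((C2.2 z).1 x)).2.
rewrite lB -!DDlF derive_comm_real ?subrr//.
exact: Ck_comp_linear.
Qed.

End SecondDerivative.

(** * The Lie algebra and the splitting so(2n,1) = u(n) + m *)

Section LieAlgebra.
Variables (R : realType) (n : nat).
Local Notation mat := (mat R n).
Local Notation J0 := (J0 R n).
Implicit Types (X Y Z g k : mat) (A C : 'M[R]_(n + n)) (u v : 'cV[R]_(n + n)).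

Lemma J0_sq : J0 *m J0 = - 1%:M.
Proof.
rewrite /Defs.J0 mulmx_block !mul0mx !mulmx0 mulNmx mul1mx mulmxN mulmx1.
by rewrite !add0r addr0 (scalar_mx_block n n 1) opp_block_mx oppr0.
Qed.

Lemma tr_J0 : J0^T = - J0.
Proof.
rewrite /Defs.J0 tr_block_mx opp_block_mx !trmx0 !oppr0 opprK.
by rewrite linearN/= trmx1.
Qed.

Lemma mulJ0K p (M : 'M[R]_(n + n, p)) : J0 *m (J0 *m M) = - M.
Proof. by rewrite mulmxA J0_sq mulNmx mul1mx. Qed.

Lemma mulmxJ0K p (M : 'M[R]_(p, n + n)) : M *m J0 *m J0 = - M.
Proof. by rewrite -mulmxA J0_sq mulmxN mulmx1. Qed.

Lemma tr_J0_mx : \tr J0 = 0.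
Proof. by rewrite /Defs.J0 mxtrace_block !linear0 addr0. Qed.

Definition lorentz : mat := block_mx 1%:M 0 0 (- 1%:M).

(** The whole Lie algebra is needed: brackets of elements of m leave m, and derivatives along them
    must still make sense. *)
Definition so21 X := X^T *m lorentz = - (lorentz *m X).

Definition br X Y := X *m Y - Y *m X.

Definition m_mx A u : mat := block_mx A u u^T 0.

Definition anti A := A^T = - A /\ A *m J0 = - (J0 *m A).

Lemma m_spaceP X : m_space X <-> exists A u, anti A /\ X = m_mx A u.
Proof.
split=> [[A [u [At AJ ->]]]|[A [u [[At AJ] ->]]]]; exists A, u.
  by split=> //; split=> //; apply/eqP; rewrite -addr_eq0 AJ.
by split=> //; rewrite AJ addNr.
Qed.

Lemma m_mx_m A u : anti A -> m_space (m_mx A u).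
Proof. by move=> aA; apply/m_spaceP; exists A, u. Qed.

Lemma m_so21 X : m_space X -> so21 X.
Proof.
move=> /m_spaceP[A [u [[At _] ->]]].
rewrite /so21 /m_mx /lorentz tr_block_mx !mulmx_block At trmxK trmx0.
rewrite !mulmx0 !mulmx1 !mul0mx !mul1mx !mulmxN !mulNmx !mulmx1 !mul1mx.
by rewrite !addr0 !add0r opp_block_mx opprK oppr0.
Qed.

Lemma so21D X Y : so21 X -> so21 Y -> so21 (X + Y).
Proof. by rewrite /so21 => sX sY; rewrite linearD/= mulmxDl sX sY mulmxDr opprD. Qed.

Lemma so21Z a X : so21 X -> so21 (a *: X).
Proof. by rewrite /so21 => sX; rewrite linearZ/= -scalemxAl sX -scalemxAr scalerN. Qed.

Lemma so21N X : so21 X -> so21 (- X).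
Proof. by rewrite -scaleN1r; exact: so21Z. Qed.

Lemma so21_br X Y : so21 X -> so21 Y -> so21 (br X Y).
Proof.
rewrite /so21 /br => sX sY.
rewrite linearB/= !trmx_mul mulmxBl -!mulmxA sX sY !mulmxN !mulmxA sX sY.
by rewrite !mulNmx !opprK mulmxBr opprB !mulmxA.
Qed.

(** The factor 1/4 is two halves: one projects onto skew matrices, the other, S to (S + J0 S J0) /
    2, onto matrices anticommuting with [J0]. *)
Definition mpart A : 'M[R]_(n + n) :=
  4^-1 *: (A - A^T + J0 *m (A - A^T) *m J0).

(** Defined on all matrices and not only on the Lie algebra, so that traces over m can be computed
    in the entry basis of the full matrix space. *)
Definition mproj X : mat := m_mx (mpart (ulsubmx X)) (ursubmx X).

Lemma mpart_anti A : anti (mpart A).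
Proof.
have := erefl ((A - A^T)^T); rewrite [RHS]linearB/= trmxK -[RHS]opprB.
rewrite /mpart; move: (A - A^T) => S St.
split.
  rewrite linearZ/= -scalerN; congr (_ *: _).
  rewrite linearD/= !trmx_mul St tr_J0 !(mulNmx, mulmxN) mulmxA.
  by rewrite !opprK [RHS]opprD.
rewrite -scalemxAl -scalemxAr -scalerN; congr (_ *: _).
rewrite mulmxDl mulmxDr mulmxJ0K !mulmxA J0_sq !mulNmx mul1mx.
by rewrite [RHS]opprD opprK addrC.
Qed.

Lemma mproj_m X : m_space (mproj X).
Proof. exact/m_mx_m/mpart_anti. Qed.

Lemma mpart_id A : anti A -> mpart A = A.
Proof.
move=> [At AJ]; rewrite /mpart At opprK -mulr2n -(scaler_nat 2 A) -scalemxAr.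
rewrite -scalemxAl -mulmxA AJ mulmxN mulJ0K opprK -mulr2n -(scaler_nat 2 (_ *: _)).
by rewrite !scalerA -natrM mulVf ?scale1r// pnatr_eq0.
Qed.

Lemma mproj_id X : m_space X -> mproj X = X.
Proof.
move=> /m_spaceP[A [u [aA ->]]].
by rewrite /mproj /m_mx block_mxKul block_mxKur mpart_id.
Qed.

Lemma m_space_mproj X : m_space X <-> mproj X = X.
Proof. by split=> [/mproj_id|<-] //; exact: mproj_m. Qed.

Lemma mpart_linear : linear mpart.
Proof.
move=> a A C; rewrite /mpart.
have -> : a *: A + C - (a *: A + C)^T = a *: (A - A^T) + (C - C^T).
  by rewrite linearP/= opprD addrACA scalerBr.
rewrite mulmxDr mulmxDl -scalemxAr -scalemxAl addrACA -(scalerDr a).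
by rewrite [LHS]scalerDr !scalerA mulrC.
Qed.

Lemma m_mx_linear a A C u v : m_mx (a *: A + C) (a *: u + v) = a *: m_mx A u + m_mx C v.
Proof.
by rewrite /m_mx scale_block_mx add_block_mx linearP/= scaler0 addr0.
Qed.

Lemma ulsubmx_linear a X Y : ulsubmx (a *: X + Y) = a *: ulsubmx X + ulsubmx Y.
Proof. by rewrite /ulsubmx !linearP. Qed.

Lemma ursubmx_linear a X Y : ursubmx (a *: X + Y) = a *: ursubmx X + ursubmx Y.
Proof. by rewrite /ursubmx !linearP. Qed.

Lemma mproj_linear : linear mproj.
Proof.
move=> a X Y; rewrite /mproj -m_mx_linear -mpart_linear.
by rewrite ulsubmx_linear ursubmx_linear.
Qed.

HB.instance Definition _ := GRing.isLinear.Build R mat mat *:%R mproj mproj_linear.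

Lemma mspaceD X Y : m_space X -> m_space Y -> m_space (X + Y).
Proof. by rewrite !m_space_mproj => mX mY; rewrite linearD/= mX mY. Qed.

Lemma mspaceZ a X : m_space X -> m_space (a *: X).
Proof. by rewrite !m_space_mproj => mX; rewrite linearZ/= mX. Qed.

Lemma mspaceB X Y : m_space X -> m_space Y -> m_space (X - Y).
Proof. by rewrite !m_space_mproj => mX mY; rewrite linearB/= mX mY. Qed.

(** On the skew block of m, right multiplication by [J0] is minus left multiplication. The opposite
    sign would make [sigma X (Jm X)] negative on that block. *)
Definition Jm X : mat := m_mx (ulsubmx X *m J0) (J0 *m ursubmx X).

Lemma Jm_linear : linear Jm.
Proof.
move=> a X Y; rewrite /Jm -m_mx_linear; congr (m_mx _ _).
  by rewrite ulsubmx_linear mulmxDl scalemxAl.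
by rewrite ursubmx_linear mulmxDr scalemxAr.
Qed.

HB.instance Definition _ := GRing.isLinear.Build R mat mat *:%R Jm Jm_linear.

Lemma Jm_m_mx A u : Jm (m_mx A u) = m_mx (A *m J0) (J0 *m u).
Proof. by rewrite /Jm /m_mx block_mxKul block_mxKur. Qed.

Lemma anti_mulJ0 A : anti A -> anti (A *m J0).
Proof.
move=> [At AJ]; split; first by rewrite trmx_mul tr_J0 At mulNmx mulmxN opprK AJ opprK.
by rewrite AJ mulmxN opprK mulNmx -mulmxA AJ mulmxN opprK.
Qed.

Lemma Jm_m X : m_space X -> m_space (Jm X).
Proof.
by move=> /m_spaceP[A [u [aA ->]]]; rewrite Jm_m_mx; exact/m_mx_m/anti_mulJ0.
Qed.

Lemma Jm_sq X : m_space X -> Jm (Jm X) = - X.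
Proof.
move=> /m_spaceP[A [u [aA ->]]]; rewrite !Jm_m_mx mulmxJ0K mulJ0K /m_mx.
by rewrite opp_block_mx linearN/= oppr0.
Qed.

Lemma sigma_m_mx A C u v :
  sigma (m_mx A u) (m_mx C v) = \tr (J0 *m u *m v^T) + \tr (J0 *m A *m C).
Proof.
rewrite /sigma /m_mx !block_mxKul !block_mxKur; congr (_ + _).
rewrite /mxtrace; apply: eq_bigr => i _.
by rewrite [RHS]mxE big_ord1 [v^T _ _]mxE.
Qed.

Lemma mul_m_mx A C u v : m_mx A u *m m_mx C v
  = block_mx (A *m C + u *m v^T) (A *m v) (u^T *m C) (u^T *m v).
Proof. by rewrite /m_mx mulmx_block !mulmx0 !mul0mx !addr0. Qed.

Definition skew u v : 'M[R]_(n + n) := u *m v^T - v *m u^T.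

Lemma skew_tr u v : (skew u v)^T = - skew u v.
Proof. by rewrite /skew linearB/= !trmx_mul !trmxK opprB. Qed.

Lemma br_m_mx A C u v : anti A -> anti C -> br (m_mx A u) (m_mx C v)
  = block_mx (A *m C - C *m A + skew u v) (A *m v - C *m u)
             (A *m v - C *m u)^T 0.
Proof.
move=> [At _] [Ct _]; rewrite /br !mul_m_mx opp_block_mx add_block_mx.
rewrite [(A *m v - C *m u)^T]linearB/= !trmx_mul At Ct !mulmxN opprK.
(* A 1 x 1 matrix is its own transpose, so the corner entry of the commutator vanishes. *)
have <- : v^T *m u = u^T *m v.
  by rewrite -[LHS]trmxK trmx_mul trmxK [X in X^T]mx11_scalar tr_scalar_mx
    -mx11_scalar.
by rewrite subrr [- _ + _]addrC /skew opprD addrACA.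
Qed.

(** A product of two [J0]-antilinear matrices is [J0]-linear. Hence [A, C] lies in u(n) and is
    invisible to [mproj]. *)
Lemma J0_comm_skew_part A C : anti A -> anti C ->
  (A *m C - C *m A) *m J0 = J0 *m (A *m C - C *m A).
Proof.
move=> [_ AJ] [_ CJ]; rewrite mulmxBl mulmxBr -!mulmxA CJ AJ !mulmxN !mulmxA.
by rewrite AJ CJ !mulNmx !opprK.
Qed.

Lemma mpart_comm A : A *m J0 = J0 *m A -> A^T = - A -> mpart A = 0.
Proof.
move=> AJ At; rewrite /mpart At opprK mulmxDr mulmxDl -AJ mulmxJ0K.
by rewrite -opprD subrr scaler0.
Qed.

Lemma mpart_skew u v : mpart (skew u v) = 2^-1 *: (skew u v + J0 *m skew u v *m J0).
Proof.
rewrite /mpart skew_tr opprK -mulr2n -(scaler_nat 2 (skew u v)) -scalemxAr.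
rewrite -scalemxAl -scalerDr scalerA; congr (_ *: _).
by rewrite -[4]/(2 * 2)%:R natrM invfM -mulrA mulVf ?mulr1// pnatr_eq0.
Qed.

HB.instance Definition _ := GRing.isLinear.Build R _ _ *:%R mpart mpart_linear.

Lemma mproj_br_m_mx A C u v : anti A -> anti C ->
  mproj (br (m_mx A u) (m_mx C v)) = m_mx (mpart (skew u v)) (A *m v - C *m u).
Proof.
move=> aA aC; rewrite (br_m_mx u v aA aC) /mproj block_mxKul block_mxKur.
congr (m_mx _ _).
rewrite linearD/= mpart_comm ?add0r//; first exact: J0_comm_skew_part.
case: aA aC => [At _] [Ct _].
by rewrite linearB/= !trmx_mul At Ct !(mulmxN, mulNmx) !opprK opprB.
Qed.

Lemma skewJ u v : mpart (skew (J0 *m u) (J0 *m v)) = - mpart (skew u v).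
Proof.
have sJ : skew (J0 *m u) (J0 *m v) = - (J0 *m skew u v *m J0).
  by rewrite /skew !trmx_mul tr_J0 mulmxBr mulmxBl !mulmxN !mulmxA opprB opprK addrC.
rewrite !mpart_skew sJ !(mulmxN, mulNmx) !mulmxA J0_sq !(mulNmx, mul1mx).
rewrite mulmxJ0K opprK -scalerN; congr (_ *: _).
by rewrite [RHS]opprD addrC.
Qed.

(** The antilinear part of [skew u v] is complex bilinear for left multiplication by [J0]. As [Jm]
    multiplies this block on the right, the sign in [mproj_br_Jl] appears. *)
Lemma skewJl u v : mpart (skew (J0 *m u) v) = J0 *m mpart (skew u v).
Proof.
rewrite !mpart_skew -scalemxAr; congr (_ *: _).
rewrite /skew trmx_mul tr_J0 !mulmxN opprK -mulmxA [v *m (_ *m _)]mulmxA.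
move: (u *m v^T) (v *m u^T) => p q.
rewrite !mulmxDr !mulmxDl !mulmxN !mulmxA J0_sq !mulNmx !mul1mx mulmxJ0K.
rewrite mulmxBr !mulmxA J0_sq !mulNmx !mul1mx opprK.
by rewrite addrACA [RHS]addrACA [- _ + q *m J0]addrC.
Qed.

Lemma m_mxN A u : - m_mx A u = m_mx (- A) (- u).
Proof. by rewrite /m_mx opp_block_mx linearN oppr0. Qed.

Lemma mproj_br_JJ X Y : m_space X -> m_space Y ->
  mproj (br (Jm X) (Jm Y)) = - mproj (br X Y).
Proof.
move=> /m_spaceP[A [u [aA ->]]] /m_spaceP[C [v [aC ->]]]; rewrite !Jm_m_mx.
rewrite !mproj_br_m_mx//; try exact: anti_mulJ0.
by rewrite skewJ m_mxN -!mulmxA !mulJ0K !mulmxN opprB opprK addrC.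
Qed.

(** Conjugate linearity of the m-part of the bracket. With [mproj_br_JJ] and [mproj_br_Jr] it makes
    the four terms of the Nijenhuis tensor equal, which cancels the factor 1/4. *)
Lemma mproj_br_Jl X Y : m_space X -> m_space Y ->
  mproj (br (Jm X) Y) = - Jm (mproj (br X Y)).
Proof.
move=> /m_spaceP[A [u [aA ->]]] /m_spaceP[C [v [aC ->]]].
rewrite [Jm (m_mx A u)]Jm_m_mx.
rewrite !mproj_br_m_mx//; try exact: anti_mulJ0.
rewrite Jm_m_mx m_mxN skewJl (mpart_anti _).2 opprK; congr m_mx.
by rewrite aA.2 mulNmx mulmxA aC.2 mulNmx opprK mulmxBr opprB addrC !mulmxA.
Qed.

Lemma mproj_br_Jr X Y : m_space X -> m_space Y ->
  mproj (br X (Jm Y)) = - Jm (mproj (br X Y)).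
Proof.
have brC Z T : br Z T = - br T Z by rewrite /br opprB.
by move=> mX mY; rewrite brC linearN/= mproj_br_Jl// (brC X) !linearN/=.
Qed.

(* For the left-invariant [Jm] and left-invariant fields, the left-hand side is
   the Nijenhuis tensor. *)
Lemma nijenhuis_alg X Y : m_space X -> m_space Y ->
  4^-1 *: (mproj (br (Jm X) (Jm Y)) - Jm (mproj (br (Jm X) Y))
    - Jm (mproj (br X (Jm Y))) - mproj (br X Y)) = - mproj (br X Y).
Proof.
move=> mX mY; rewrite mproj_br_JJ// mproj_br_Jl// mproj_br_Jr// !linearN/=.
rewrite (Jm_sq (mproj_m _)) !opprK; move: (- _) => Z.
rewrite -{1 2 3 4}[Z]scale1r -!scalerDl scalerA.
by rewrite (_ : _ * _ = 1) ?scale1r//; field.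
Qed.

Lemma sigma_J X Y : m_space X -> m_space Y ->
  sigma (Jm X) (Jm Y) = sigma X Y.
Proof.
move=> /m_spaceP[A [u [aA ->]]] /m_spaceP[C [v [aC ->]]]; rewrite !Jm_m_mx.
rewrite !sigma_m_mx; congr (_ + _).
  rewrite trmx_mul tr_J0 mulmxA J0_sq mulNmx mul1mx !mulmxN mulNmx opprK mulmxA.
  by rewrite mxtrace_mulC mulmxA.
rewrite aC.2 -mulmxA !mulmxN -[A *m J0 *m _]mulmxA mulJ0K !mulmxN opprK.
by rewrite mulmxA.
Qed.

Lemma mxtrace_mul_tr_ge0 p q (M : 'M[R]_(p, q)) :
  0 <= \tr (M *m M^T) ?= iff (M == 0).
Proof.
have -> : \tr (M *m M^T) = \sum_i \sum_j M i j ^+ 2.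
  by apply: eq_bigr => i _; rewrite mxE; apply: eq_bigr => j _; rewrite mxE.
split; first by apply: sumr_ge0 => i _; apply: sumr_ge0 => j _; exact: sqr_ge0.
rewrite eq_sym psumr_eq0; last first.
  by move=> i _; apply: sumr_ge0 => j _; exact: sqr_ge0.
apply/allP/eqP => [M0|-> i _]; last first.
  by apply/eqP/big1 => j _; rewrite mxE expr0n.
apply/matrixP => i j; rewrite mxE; apply/eqP; rewrite -sqrf_eq0.
have := M0 i (mem_index_enum i); rewrite /= psumr_eq0; last by move=> *; exact: sqr_ge0.
by move=> /allP/(_ j (mem_index_enum j)).
Qed.

Lemma sigma_pos X : m_space X -> X != 0 -> 0 < sigma X (Jm X).
Proof.
move=> /m_spaceP[A [u [aA ->]]]; rewrite Jm_m_mx sigma_m_mx => nz.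
(* Both traces become squared Euclidean norms, of [J0 *m u] and of [J0 *m A]. *)
have -> : A *m J0 = (J0 *m A)^T by rewrite trmx_mul aA.1 tr_J0 mulNmx mulmxN opprK.
have H1 := mxtrace_mul_tr_ge0 (J0 *m u); have H2 := mxtrace_mul_tr_ge0 (J0 *m A).
have := addr_ge0 H1 H2; rewrite le0r => /orP[|//].
rewrite paddr_eq0 ?H1 ?H2// eq_sym H1.2 [\tr _ == 0]eq_sym H2.2.
move=> /andP[/eqP Ju /eqP JA].
case/eqP: nz; rewrite /m_mx -[u]opprK -(mulJ0K u) Ju -[A]opprK -(mulJ0K A) JA.
by rewrite !mulmx0 !oppr0 linear0; exact: block_mx0.
Qed.

Definition kblock (w : 'M[R]_(n + n)) : mat := block_mx w 0 0 0.

Lemma kblock_so21 (w : 'M[R]_(n + n)) : w^T = - w -> so21 (kblock w).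
Proof.
move=> wt; rewrite /so21 /kblock /lorentz tr_block_mx !mulmx_block wt.
rewrite !trmx0 !(mulmx0, mul0mx, mulmx1, mul1mx, addr0, add0r).
by rewrite opp_block_mx !oppr0.
Qed.

Lemma br_kblock (w : 'M[R]_(n + n)) A u : w^T = - w ->
  br (kblock w) (m_mx A u) = m_mx (w *m A - A *m w) (w *m u).
Proof.
move=> wt; rewrite /br /kblock /m_mx !mulmx_block !mulmx0 !mul0mx !addr0.
rewrite opp_block_mx add_block_mx trmx_mul wt mulmxN.
by rewrite !subr0 sub0r.
Qed.

Lemma br_kblock_m (w : 'M[R]_(n + n)) X : w^T = - w -> w *m J0 = J0 *m w ->
  m_space X -> m_space (br (kblock w) X).
Proof.
move=> wt wJ /m_spaceP[A [u [aA ->]]]; rewrite br_kblock//; apply: m_mx_m.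
split; first by rewrite linearB/= !trmx_mul wt aA.1 !(mulmxN, mulNmx) !opprK opprB.
rewrite mulmxBl mulmxBr -!mulmxA wJ aA.2 mulmxN !mulmxA wJ aA.2.
by rewrite mulNmx opprB opprK addrC.
Qed.

(** Collects what is needed about the fibre component of the bracket: it lies in u(n), and pairing
    it with [J0] recovers [sigma], which is how the symplectic form enters the Ricci form. *)
Lemma br_k_part X Y : m_space X -> m_space Y ->
  exists w : 'M[R]_(n + n), [/\ w^T = - w, w *m J0 = J0 *m w,
    br X Y - mproj (br X Y) = kblock w & \tr (J0 *m w) = 2 * sigma X Y].
Proof.
move=> /m_spaceP[A [u [aA ->]]] /m_spaceP[C [v [aC ->]]].
(* All of [A, C] is [J0]-linear already; only [skew u v] has an antilinear part to be removed. *)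
exists (A *m C - C *m A + (skew u v - mpart (skew u v))).
have [mt mJ] := mpart_anti (skew u v).
split.
- have t1 : (A *m C - C *m A)^T = - (A *m C - C *m A).
    by rewrite linearB/= !trmx_mul aA.1 aC.1 !mulNmx !mulmxN !opprK opprB.
  have t2 : (skew u v - mpart (skew u v))^T = - (skew u v - mpart (skew u v)).
    by rewrite linearB/= skew_tr mt -opprD.
  by rewrite linearD/= t1 t2 -opprD.
- rewrite mulmxDl mulmxDr (J0_comm_skew_part aA aC); congr (_ + _).
  have -> : skew u v - mpart (skew u v)
      = 2^-1 *: (skew u v - J0 *m skew u v *m J0).
    rewrite mpart_skew; move: (skew u v) => S.
    have h : S = 2^-1 *: S + 2^-1 *: S.
      by rewrite -scalerDl (_ : _ + _ = 1) ?scale1r//; field.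
    by rewrite {1}h scalerDr scalerBr opprD addrACA addrN add0r.
  rewrite -scalemxAl -scalemxAr; congr (_ *: _); move: (skew u v) => S.
  by rewrite mulmxBl mulmxBr mulmxJ0K !mulmxA J0_sq !mulNmx mul1mx !opprK addrC.
- rewrite mproj_br_m_mx// br_m_mx// /kblock /m_mx opp_block_mx add_block_mx.
  by rewrite -addrA !addrN.
(* Antilinear matrices are orthogonal to [J0], so removing the m-part does not change the trace. *)
- have trJ0C M : anti M -> \tr (J0 *m M) = 0.
    move=> [_ MJ]; apply/eqP; rewrite -[_ == 0](mulrn_eq0 _ 2) mulr2n.
    by rewrite {1}mxtrace_mulC MJ linearN/= addNr.
  have -> : \tr (J0 *m (A *m C - C *m A + (skew u v - mpart (skew u v))))
      = \tr (J0 *m (A *m C - C *m A)) + \tr (J0 *m skew u v).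
    have trB M S : anti M -> \tr (J0 *m (S - M)) = \tr (J0 *m S).
      by move=> aM; rewrite mulmxBr linearB/= (trJ0C _ aM) subr0.
    by rewrite mulmxDr linearD/= (trB (mpart _) (skew u v))//; exact: mpart_anti.
  have -> : \tr (J0 *m (A *m C - C *m A)) = 2 * \tr (J0 *m A *m C).
    have e : \tr (J0 *m (C *m A)) = - \tr (J0 *m A *m C).
      by rewrite mulmxA mxtrace_mulC mulmxA aA.2 mulNmx linearN.
    by rewrite mulmxBr linearB/= e opprK mulmxA mulr_natl mulr2n.
  have -> : \tr (J0 *m skew u v) = 2 * \tr (J0 *m u *m v^T).
    have e : \tr (J0 *m (v *m u^T)) = - \tr (J0 *m u *m v^T).
      by rewrite -mxtrace_tr !trmx_mul trmxK tr_J0 mulmxN linearN/= mxtrace_mulC mulmxA.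
    by rewrite /skew mulmxBr linearB/= e opprK mulmxA mulr_natl mulr2n.
  by rewrite sigma_m_mx mulrDr addrC.
Qed.

End LieAlgebra.

(** * Traces over m *)

Section Trace.
Variables (R : realType).

(** Meant for linear [f], where it is the trace in the basis of matrix units. Taking a plain
    function avoids packaging every formula as an endomorphism. *)
Definition optrace p (f : 'M[R]_p -> 'M[R]_p) : R :=
  \sum_i \sum_j f (delta_mx i j) i j.

Lemma mulmx_delta_mulmxE p (M N : 'M[R]_p) i j k l :
  (M *m delta_mx k l *m N) i j = M i k * N l j.
Proof.
rewrite mxE (bigD1 l)//= big1 ?addr0; last first.
  move=> r rl; rewrite mxE big1 ?mul0r// => s _.
  by rewrite mxE (negbTE rl) andbF mulr0.
rewrite mxE (bigD1 k)//= big1 ?addr0; last first.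
  by move=> s sk; rewrite mxE (negbTE sk) mulr0.
by rewrite mxE !eqxx mulr1.
Qed.

(** The map is the tensor product of [M] with the transpose of [N]. *)
Lemma optrace_mul p (M N : 'M[R]_p) :
  optrace (fun E => M *m E *m N) = \tr M * \tr N.
Proof.
rewrite /optrace /mxtrace big_distrl/=; apply: eq_bigr => i _.
rewrite big_distrr/=; apply: eq_bigr => j _.
by rewrite mulmx_delta_mulmxE.
Qed.

(** Transposition swaps the two tensor factors, so the product of traces collapses to the trace of a
    product. *)
Lemma optrace_mul_tr p (M N : 'M[R]_p) :
  optrace (fun E => M *m E^T *m N) = \tr (M *m N^T).
Proof.
rewrite /optrace /mxtrace; apply: eq_bigr => i _.
rewrite mxE; apply: eq_bigr => j _.
by rewrite trmx_delta mulmx_delta_mulmxE mxE.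
Qed.

Lemma optraceD p (f g : 'M[R]_p -> 'M[R]_p) :
  optrace (fun E => f E + g E) = optrace f + optrace g.
Proof.
rewrite /optrace -big_split; apply: eq_bigr => i _.
by rewrite -big_split; apply: eq_bigr => j _; rewrite mxE.
Qed.

Lemma optraceZ p a (f : 'M[R]_p -> 'M[R]_p) :
  optrace (fun E => a *: f E) = a * optrace f.
Proof.
rewrite /optrace big_distrr; apply: eq_bigr => i _.
by rewrite big_distrr; apply: eq_bigr => j _; rewrite mxE.
Qed.

Lemma optraceN p (f : 'M[R]_p -> 'M[R]_p) :
  optrace (fun E => - f E) = - optrace f.
Proof.
under [in LHS]eq_fun do rewrite -scaleN1r.
by rewrite optraceZ mulN1r.
Qed.

Variable n : nat.
Local Notation J0 := (J0 R n).

(** Expanding [mpart] leaves maps in E and in its transpose. Among the former, those with a factor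
    tr J0 vanish and the two with an identity factor, of trace 2n, give - 4n tr (J0 w); the latter
    give 4 tr (J0 w). The factor 1/4 yields 1 - n. *)
Lemma optrace_ad_mpart (w : 'M[R]_(n + n)) : w^T = - w -> w *m J0 = J0 *m w ->
  optrace (fun E => (w *m mpart E - mpart E *m w) *m J0)
  = (1 - n%:R) * \tr (J0 *m w).
Proof.
move=> wt wJ.
have comm_anti G : (w *m (G + J0 *m G *m J0) - (G + J0 *m G *m J0) *m w) *m J0
    = w *m G *m J0 + - (J0 *m w *m G *m 1%:M) + - (1%:M *m G *m (J0 *m w))
      + J0 *m G *m w.
  rewrite mulmx1 mul1mx mulmxDr (mulmxDl G) !mulmxA.
  rewrite -[J0 *m G *m J0 *m w]mulmxA -wJ [J0 *m G *m (w *m J0)]mulmxA.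
  rewrite opprD addrACA mulmxDl !mulmxBl !mulmxJ0K opprK wJ addrACA.
  by rewrite -!mulmxA wJ !addrA.
have -> : (fun E => (w *m mpart E - mpart E *m w) *m J0) =
  (fun E => 4^-1 *: (
    (w *m E *m J0 + - (J0 *m w *m E *m 1%:M) + - (1%:M *m E *m (J0 *m w))
      + J0 *m E *m w) -
    (w *m E^T *m J0 + - (J0 *m w *m E^T *m 1%:M) + - (1%:M *m E^T *m (J0 *m w))
      + J0 *m E^T *m w))).
  apply/funext => E; rewrite -!comm_anti /mpart -scalemxAr -scalemxAl -scalerBr.
  rewrite -scalemxAl; congr (_ *: _).
  have -> : E - E^T + J0 *m (E - E^T) *m J0
      = (E + J0 *m E *m J0) - (E^T + J0 *m E^T *m J0).
    by rewrite mulmxBr mulmxBl opprD addrACA.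
  move: (E + _) (E^T + _) => a b.
  by rewrite mulmxBr (mulmxBl a b w) opprD addrACA -opprD mulmxBl.
rewrite optraceZ optraceD optraceN !optraceD !optraceN.
rewrite !optrace_mul !optrace_mul_tr !trmx1 !mulmx1 !mul1mx !mxtrace1.
rewrite !tr_J0_mx trmx_mul wt tr_J0 !(mulmxN, mulNmx) opprK wJ.
have trN M : \tr (- M : 'M[R]_(n + n)) = - \tr M by exact: linearN.
rewrite !trN natrD.
by move: (\tr (J0 *m w)) => t; field.
Qed.

Local Notation mat := (mat R n).

Lemma optrace_block (f : mat -> mat) (h1 : 'M[R]_(n + n) -> 'M[R]_(n + n))
    (h2 : 'cV[R]_(n + n) -> 'cV[R]_(n + n)) :
  (forall E, f E = m_mx (h1 (ulsubmx E)) (h2 (ursubmx E))) ->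
  h1 0 = 0 -> h2 0 = 0 ->
  optrace f = optrace h1 + \sum_i h2 (delta_mx i 0) i 0.
Proof.
move=> fE h10 h20; rewrite /optrace big_split_ord/= [X in _ + X]big1 ?addr0.
  rewrite -big_split; apply: eq_bigr => i _ /=.
  rewrite big_split_ord/= big_ord1; congr (_ + _).
    apply: eq_bigr => j _; rewrite fE /m_mx block_mxEul; congr (h1 _ _ _).
    by apply/matrixP => k l; rewrite !mxE !eq_shift.
  rewrite fE /m_mx block_mxEur; congr (h2 _ _ _).
    by apply/matrixP => k l; rewrite !mxE !eq_shift ?andbF ?(ord1 l).
move=> i _; rewrite big_split_ord/= big_ord1 fE /m_mx block_mxEdr mxE addr0.
rewrite big1// => j _; rewrite fE /m_mx block_mxEdl mxE.
rewrite (_ : ursubmx _ = 0) ?h20 ?mxE//.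
by apply/matrixP => k l; rewrite !mxE !eq_shift ?andbF ?(ord1 l).
Qed.

(** The constant n - 2 is n - 1 from the skew block and - 1 from the vector block. *)
Lemma optrace_curvature (w : 'M[R]_(n + n)) : w^T = - w -> w *m J0 = J0 *m w ->
  optrace (fun E : mat => - Jm (br (kblock w) (mproj E)))
  = (n%:R - 2) * \tr (J0 *m w).
Proof.
move=> wt wJ.
rewrite (@optrace_block _ (fun E => - ((w *m mpart E - mpart E *m w) *m J0))
  (fun u => - (J0 *m (w *m u)))) ?mulmx0 ?oppr0//; last 2 first.
- by move=> E; rewrite /mproj br_kblock// Jm_m_mx m_mxN.
- by rewrite linear0 mulmx0 mul0mx subrr mul0mx oppr0.
rewrite optraceN optrace_ad_mpart//.
have -> : \sum_i (- (J0 *m (w *m delta_mx i (0 : 'I_1)))) i 0 = - \tr (J0 *m w).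
  rewrite /mxtrace -sumrN; apply: eq_bigr => i _.
  by rewrite mxE mulmxA -colE mxE.
by ring.
Qed.

(** The trace of S on the range of the projection P is the trace of S P on the whole space, where
    matrix units are available as a basis. *)
Lemma coord_trace (P : {linear mat -> mat}) d (b : d.-tuple mat)
    (S : {linear mat -> mat}) :
  free b -> (forall X, X \in <<b>>%VS <-> P X = X) ->
  (forall X, P (P X) = P X) -> (forall X, P X = X -> P (S X) = S X) ->
  \sum_(i < d) coord b i (S (tnth b i)) = optrace (fun E => S (P E)).
Proof.
move=> fb spanb PP SP.
have PE E : P E = \sum_(i < d) coord b i (P E) *: tnth b i.
  under eq_bigr do rewrite (tnth_nth 0).
  by apply: coord_span; apply/spanb.
have bP i : P (tnth b i) = tnth b i.
  by apply/spanb/memv_span/mem_tnth.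
rewrite /optrace.
under [RHS]eq_bigr => k _.
  under eq_bigr => l _.
    rewrite [P _]PE linear_sum summxE.
    under eq_bigr do rewrite linearZ mxE.
    over.
  rewrite exchange_big; over.
rewrite exchange_big; apply: eq_bigr => i _ /=.
(* With P inserted, expanding the image of b_i in matrix units produces the same coordinates of
   [P (delta_mx k l)] as on the right. *)
rewrite -{1}(SP _ (bP i)) {1}[S (tnth b i)]matrix_sum_delta.
rewrite !linear_sum; apply: eq_bigr => k _.
rewrite !linear_sum; apply: eq_bigr => l _.
by rewrite !linearZ/= mulrC.
Qed.

Lemma trace_m_exists (S : 'End(mat)) :
  (forall X, m_space X -> m_space (S X)) ->
  is_trace_m S (optrace (fun E => S (mproj E))).
Proof.
move=> Sm; split=> //.
pose V := limg (linfun (@mproj R n)).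
have spanV X : X \in <<vbasis V>>%VS <-> mproj X = X.
  rewrite (span_basis (vbasisP V)); split=> [/memv_imgP[Y _ ->]|<-].
    by rewrite lfunE/=; apply/mproj_id/mproj_m.
  by rewrite -[mproj X]lfunE; apply: memv_img; exact: memvf.
exists (\dim V), (vbasis V); split.
- exact: basis_free (vbasisP V).
- by move=> X; rewrite spanV; exact: m_space_mproj.
- apply/esym; apply: coord_trace => //.
  + exact: basis_free (vbasisP V).
  + by move=> X; apply/mproj_id/mproj_m.
  + by move=> X /m_space_mproj/Sm/mproj_id.
Qed.

End Trace.

(** * Curves in SO(2n,1) *)

Section Group.
Variables (R : realType) (n : nat).
Local Notation mat := (mat R n).
Local Notation J0 := (J0 R n).
Local Notation lorentz := (lorentz R n).
Implicit Types (X Y Z g h k : mat).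

Definition Oquad : set mat := [set g | forall v, quad (g *m v) = quad v].

Lemma quadE (v : 'cV[R]_(n + n + 1)) : quad v = (v^T *m lorentz *m v) 0 0.
Proof.
rewrite -mulmxA mxE big_split_ord/= big_ord1 /quad.
rewrite -[v in lorentz *m v]vsubmxK /lorentz mul_block_col !mul0mx mul1mx mulNmx mul1mx.
rewrite addr0 add0r; congr (_ + _).
  by apply: eq_bigr => i _; rewrite mxE col_mxEu mxE expr2.
by rewrite mxE col_mxEd [in RHS]mxE [in RHS]mxE mulrN expr2.
Qed.

Lemma tr_lorentz : lorentz^T = lorentz.
Proof. by rewrite /lorentz tr_block_mx !trmx0 trmx1 linearN/= trmx1. Qed.

Lemma delta_mulE p (M : 'M[R]_p) i j :
  (delta_mx (0 : 'I_1) i *m M *m delta_mx j (0 : 'I_1)) 0 0 = M i j.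
Proof. by rewrite -colE -rowE !mxE. Qed.

(** Polarization: a symmetric matrix whose quadratic form vanishes on e_i and e_i + e_j has all
    entries zero. *)
Lemma OquadP g : Oquad g <-> g^T *m lorentz *m g = lorentz.
Proof.
split=> [Og|Og v]; last first.
  by rewrite !quadE trmx_mul -[in RHS]Og !mulmxA.
pose M := g^T *m lorentz *m g - lorentz.
have Mt : M^T = M by rewrite /M linearB/= !trmx_mul trmxK tr_lorentz mulmxA.
have M0 (v : 'cV[R]_(n + n + 1)) : (v^T *m M *m v) 0 0 = 0.
  have := Og v; rewrite !quadE trmx_mul -!mulmxA => Ov.
  rewrite /M -!mulmxA mulmxBl mulmxBr -!mulmxA.
  by rewrite [LHS]mxE [X in _ + X]mxE Ov subrr.
have Md i : M i i = 0.
  by have := M0 (delta_mx i 0); rewrite trmx_delta delta_mulE.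
have Msym i j : M j i = M i j by rewrite -[in LHS]Mt mxE.
apply/eqP; rewrite -subr_eq0 -/M; clearbody M.
apply/eqP/matrixP => i j; rewrite [RHS]mxE.
have := M0 (delta_mx i 0 + delta_mx j 0).
rewrite [(_ + _)^T]linearD/= !trmx_delta mulmxDl mulmxDl !mulmxDr.
rewrite [LHS]mxE [X in X + _]mxE [X in _ + X]mxE !delta_mulE !Md Msym.
by rewrite add0r addr0 -mulr2n => /eqP; rewrite mulrn_eq0 => /eqP.
Qed.

Lemma SO_sub g : SO g -> Oquad g.
Proof. exact: connected_component_sub. Qed.

Lemma mulmx_continuous g : continuous (mulmx g : mat -> mat).
Proof.
by apply: matrix_linear_continuous => a X Y; rewrite mulmxDr scalemxAr.
Qed.

(** Left translation by g carries a connected set joining 1 to h to one joining g to g h. *)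
Lemma SO_mul g h : SO g -> SO h -> SO (g *m h).
Proof.
move=> SOg [B [B1 BO cB] Bh].
apply: (connected_component_trans (SOg : connected_component _ _ _)).
exists [set g *m b | b in B]; last by exists h.
split; first by exists 1%:M; rewrite ?mulmx1.
  move=> _ [b Bb <-]; apply/OquadP.
  have -> : (g *m b)^T *m lorentz *m (g *m b) = b^T *m (g^T *m lorentz *m g) *m b.
    by rewrite trmx_mul !mulmxA.
  by rewrite ((OquadP g).1 (SO_sub SOg)); exact/OquadP/BO.
apply: connected_continuous_connected => //.
exact/continuous_subspaceT/mulmx_continuous.
Qed.

Lemma SO_unit g : SO g -> g \in unitmx.
Proof.
move=> /SO_sub/OquadP gO.
have lorentz2 : lorentz *m lorentz = 1%:M.
  rewrite /lorentz mulmx_block !mul0mx !mulmx0 mulNmx mulmxN !mul1mx opprK.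
  by rewrite !addr0 add0r -scalar_mx_block.
have e : lorentz *m g^T *m lorentz *m g = 1%:M.
  by rewrite -!mulmxA [g^T *m _]mulmxA gO.
by case/mulmx1_unit: e.
Qed.

Lemma det_continuous_at p (T : topologicalType) (A : T -> 'M[R]_p) :
  (forall i j, continuous (fun t => A t i j)) ->
  continuous (fun t => \det (A t)).
Proof.
move=> cA; rewrite /determinant; apply: sum_continuous => s t.
apply: cvgM; first exact: cvg_cst.
apply: continuous_big; first exact: mul_continuous.
by move=> i _; exact: cA.
Qed.

Lemma matrix_entries_cvg p q (T : Type) (F : set_system T) (A : T -> 'M[R]_(p, q))
    (B : 'M[R]_(p, q)) : Filter F ->
  (forall i j, A t i j @[t --> F] --> B i j) -> A t @[t --> F] --> B.
Proof.
move=> FF cA.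
have -> : A = (fun t => \sum_i \sum_j A t i j *: delta_mx i j).
  by apply/funext => t; exact: matrix_sum_delta.
rewrite [X in _ --> X]matrix_sum_delta.
apply: cvg_big; first exact: add_continuous.
move=> i _; apply: cvg_big; first exact: add_continuous.
by move=> j _; apply: cvgZr_tmp; exact: cA.
Qed.

Lemma invmx_continuous_at p (T : topologicalType) (A : T -> 'M[R]_p) t :
  (forall i j, continuous (fun t => A t i j)) -> A t \in unitmx ->
  {for t, continuous (fun t => invmx (A t))} /\ \forall s \near t, A s \in unitmx.
Proof.
move=> cA uA.
have cdet := @det_continuous_at p T A cA.
have unear : \forall s \near t, A s \in unitmx.
  have : \forall s \near t, \det (A s) != 0.
    by apply: (cvgr_neq0 _ (cdet t)); rewrite -unitfE -unitmxE.
  by apply: filterS => s; rewrite unitmxE unitfE.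
split; last exact: unear.
have adjE : {near t, (fun s => (\det (A s))^-1 *: \adj (A s)) =1
    (fun s => invmx (A s))}.
  by near=> s; rewrite /invmx ifT//; near: s.
rewrite /continuous_at; apply: cvg_trans (near_eq_cvg adjE) _.
rewrite /invmx uA.
apply: cvgZ; first by apply: cvgV; [rewrite -unitfE -unitmxE|exact: cdet].
apply: matrix_entries_cvg => i j.
under eq_cvg do rewrite mxE /cofactor.
rewrite mxE /cofactor; apply: cvgM; first exact: cvg_cst.
have cm r c : continuous (fun s => row' j (col' i (A s)) r c).
  by under eq_fun do rewrite !mxE; exact: cA.
exact: (det_continuous_at cm).
Unshelve. all: by end_near. Qed.

(* A curve in SO(2n,1) through 1 with velocity 2 Y, which avoids the matrix
   exponential. *)
Definition cayley Y (t : R) : mat := invmx (1%:M - t *: Y) *m (1%:M + t *: Y).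

Section Cayley.
Variable Y : mat.

Lemma pencil_continuous i j : continuous (fun t : R => (1%:M - t *: Y) i j).
Proof.
move=> t; under eq_fun do rewrite !mxE.
apply: cvgB; first exact: cvg_cst.
by apply: cvgM; [exact: cvg_id|exact: cvg_cst].
Qed.

Lemma cayley_unit_near : \forall t \near (0 : R), (1%:M - t *: Y) \in unitmx.
Proof.
have [] // := @invmx_continuous_at _ _ (fun t : R => 1%:M - t *: Y) 0 pencil_continuous.
by rewrite scale0r subr0 unitmx1.
Qed.

Lemma cayley_continuous (t : R) : (1%:M - t *: Y) \in unitmx ->
  {for t, continuous (cayley Y)}.
Proof.
move=> ut.
have [ci _] := invmx_continuous_at pencil_continuous ut.
apply: (@continuous2_cvg _ _ _ _ _ _ _ _ (@mulmx R _ _ _)).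
- apply: matrix_bilinear_continuous => [X a Z T|X|Z a X T].
  + by rewrite mulmxDr scalemxAr.
  + exact: mulmx_continuous.
  + by rewrite mulmxDl scalemxAl.
- exact: ci.
- by apply: cvgD; [exact: cvg_cst|apply: cvgZr_tmp; exact: cvg_id].
Qed.

Lemma cayley0 : cayley Y 0 = 1%:M.
Proof. by rewrite /cayley scale0r subr0 addr0 mulmx1 invmx1. Qed.

(** From (1 - h Y) c(h) = 1 + h Y one gets c(h) - 1 = h (Y + Y c(h)), so continuity of the curve c
    suffices and no inverse has to be differentiated. *)
Lemma is_derive_cayley : is_derive (0 : R) 1 (cayley Y) (Y + Y).
Proof.
have cY : (h^-1 *: ((cayley Y \o shift 0) (h *: (1 : R)) - cayley Y 0))
    @[h --> 0^'] --> Y + Y.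
  have cvgYc : Y + Y *m cayley Y h @[h --> 0^'] --> Y + Y.
    rewrite [X in _ --> X](_ : _ = Y + Y *m cayley Y 0); last first.
      by rewrite cayley0 mulmx1.
    apply: cvgD; first exact: cvg_cst.
    have cvgc : cayley Y h @[h --> 0^'] --> cayley Y 0.
      apply: cvg_within_filter.
      by apply: cayley_continuous; rewrite scale0r subr0 unitmx1.
    exact: cvg_comp cvgc (@mulmx_continuous Y _).
  apply: cvg_trans cvgYc; apply: near_eq_cvg.
  near=> h.
  have h0 : h != 0 by near: h; exact: nbhs_dnbhs_neq.
  have uh : 1%:M - h *: Y \in unitmx.
    by near: h; apply: nbhs_dnbhs; exact: cayley_unit_near.
  rewrite /= addr0 [h *: 1]mulr1 cayley0.
  have -> : cayley Y h - 1%:M = h *: (Y + Y *m cayley Y h).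
    have : (1%:M - h *: Y) *m cayley Y h = 1%:M + h *: Y.
      by rewrite /cayley mulKVmx.
    rewrite mulmxBl mul1mx -scalemxAl => /eqP; rewrite subr_eq => /eqP {1}->.
    by rewrite scalerDr [_ - 1%:M]addrC !addrA addNr add0r.
  by rewrite scalerA mulVf// scale1r.
apply: DeriveDef; first exact: cvgP cY.
exact: cvg_lim cY.
Unshelve. all: by end_near. Qed.
End Cayley.

(** Moving a transpose across the Lorentz form exchanges 1 - t Y with 1 + t Y, and these two
    commute. *)
Lemma cayley_Oquad Y t : so21 Y -> 1%:M - t *: Y \in unitmx -> Oquad (cayley Y t).
Proof.
move=> sY; rewrite /cayley; set A := 1%:M - _ => uA; set B := 1%:M + _.
have AB : A *m B = B *m A.
  have AtY : A *m (t *: Y) = (t *: Y) *m A.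
    by rewrite /A mulmxBl mulmxBr mul1mx mulmx1.
  by rewrite /B mulmxDr mulmxDl mulmx1 mul1mx AtY.
have AtB : A^T *m lorentz = lorentz *m B.
  rewrite /A /B linearB/= trmx1 linearZ/= mulmxBl mul1mx -scalemxAl sY.
  by rewrite mulmxDr mulmx1 -scalemxAr scalerN opprK.
have BtA : B^T *m lorentz = lorentz *m A.
  rewrite /A /B linearD/= trmx1 linearZ/= mulmxDl mul1mx -scalemxAl sY.
  by rewrite mulmxBr mulmx1 -scalemxAr scalerN.
have uAt : A^T \in unitmx by rewrite unitmx_tr.
have cE : invmx A *m B = B *m invmx A.
  by rewrite -[B in LHS](mulmxK uA) -AB -mulmxA mulKmx.
apply/OquadP; rewrite cE trmx_mul trmx_inv -[_ *m B^T *m _]mulmxA BtA.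
by rewrite -!mulmxA [A *m (B *m _)]mulmxA AB mulmxK// -AtB mulKmx.
Qed.

(** As [SO] is a connected component, preserving [quad] is not enough. The connecting set is the
    curve itself over a ball on which 1 - s Y stays invertible. *)
Lemma cayley_SO_near Y : so21 Y -> \forall t \near (0 : R), SO (cayley Y t).
Proof.
move=> sY; have /nbhs_ballP[e /= e0 He] := cayley_unit_near Y.
apply/nbhs_ballP; exists e => //= t bt.
exists [set cayley Y s | s in ball (0 : R) e]; last by exists t.
split; first by exists 0; [exact: ballxx|exact: cayley0].
  by move=> _ [s /He us <-]; exact: cayley_Oquad.
apply: connected_continuous_connected.
  apply/connected_intervalP => x y; rewrite /ball/= !sub0r !normrN !ltr_norml.
  move=> /andP[ex _] /andP[_ ye] z /andP[xz zy].
  by rewrite sub0r normrN ltr_norml (lt_le_trans ex xz) (le_lt_trans zy ye).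
apply: continuous_in_subspaceT => s; rewrite inE => /He; exact: cayley_continuous.
Qed.

Lemma cayley_comm Y t (M : mat) : 1%:M - t *: Y \in unitmx ->
  Y *m M = M *m Y -> cayley Y t *m M = M *m cayley Y t.
Proof.
move=> ut YM; rewrite /cayley -mulmxA.
have -> : (1%:M + t *: Y) *m M = M *m (1%:M + t *: Y).
  by rewrite mulmxDl mulmxDr mul1mx mulmx1 -scalemxAl -scalemxAr YM.
have AM : (1%:M - t *: Y) *m M = M *m (1%:M - t *: Y).
  by rewrite mulmxBl mulmxBr mul1mx mulmx1 -scalemxAl -scalemxAr YM.
by rewrite !mulmxA; congr (_ *m _); rewrite -[M in LHS](mulmxK ut) -AM -mulmxA mulKmx.
Qed.

Lemma cayley_fix Y t (M : mat) : 1%:M - t *: Y \in unitmx ->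
  Y *m M = 0 -> cayley Y t *m M = M.
Proof.
move=> ut YM; rewrite /cayley -mulmxA mulmxDl mul1mx -scalemxAl YM scaler0 addr0.
have AM : (1%:M - t *: Y) *m M = M.
  by rewrite mulmxBl mul1mx -scalemxAl YM scaler0 subr0.
by rewrite -[in LHS]AM mulKmx.
Qed.

Lemma derive_along_cayley (W : normedModType R) (H : mat -> W) g Y :
  differentiable H g -> (\forall t \near (0 : R), H (g *m cayley Y t) = 0) ->
  'D_(g *m (Y + Y)) H g = 0.
Proof.
move=> dH H0.
have dg : is_derive (0 : R) 1 (fun t => g *m cayley Y t) (g *m (Y + Y)).
  have [dc <-] := is_derive_cayley Y.
  have dc' : differentiable (cayley Y) 0 by exact/derivable1_diffP.
  have gl : linear (mulmx g : mat -> mat).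
    by move=> a X Z; rewrite mulmxDr scalemxAr.
  have [d1 d2] := differentiable_linear_comp gl (@mulmx_continuous g) dc'.
  by apply: DeriveDef; [exact: diff_derivable|exact: d2].
have dH' : differentiable H (g *m cayley Y 0) by rewrite cayley0 mulmx1.
have [_] := derive1_comp_curve dg dH'; rewrite cayley0 mulmx1 => <-.
have -> : 'D_1 (H \o (fun t => g *m cayley Y t)) 0 = 'D_1 (cst 0) (0 : R).
  exact: near_eq_derive.
by rewrite derive_cst.
Qed.

(** Reaches an arbitrary direction X in spite of the doubled velocity of [cayley]. *)
Lemma half_double X : X = 2^-1 *: X + 2^-1 *: X.
Proof. by rewrite -scalerDl (_ : _ + _ = 1) ?scale1r//; field. Qed.

Lemma cayley_near g Y (P : set mat) : (\forall h \near g, P h) ->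
  \forall t \near (0 : R), P (g *m cayley Y t).
Proof.
have c0 : cayley Y t @[t --> (0 : R)] --> cayley Y 0.
  by apply: cayley_continuous; rewrite scale0r subr0 unitmx1.
have := cvg_comp _ _ c0 (@mulmx_continuous g _).
by rewrite cayley0 mulmx1 => + /=; apply.
Qed.

(** Applied in [derE] to the difference of two extensions of one function: tangential derivatives
    see only the values on the group. *)
Lemma derive_SO_eq0 (W : normedModType R) (H : mat -> W) g X :
  SO g -> so21 X -> differentiable H g ->
  (\forall h \near g, SO h -> H h = 0) -> 'D_(g *m X) H g = 0.
Proof.
move=> SOg sX dH H0; rewrite (half_double X); apply: derive_along_cayley => //.
have := cayley_near (2^-1 *: X) H0.
apply: filterS2 (cayley_SO_near (so21Z 2^-1 sX)) => t SOt; apply.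
exact: SO_mul.
Qed.

Definition kmat (k0 : 'M[R]_(n + n)) : mat := block_mx k0 0 0 1%:M.

Lemma U_kmat k : U k -> exists k0 : 'M[R]_(n + n),
  [/\ k = kmat k0, k0^T *m k0 = 1%:M, k0 *m k0^T = 1%:M & k0 *m J0 = J0 *m k0].
Proof.
move=> [/SO_sub/OquadP kO [k0 kE kJ]]; exists k0.
have kk : k0^T *m k0 = 1%:M.
  move: kO; rewrite kE tr_block_mx !mulmx_block !trmx0 trmx1.
  rewrite !(mulmx0, mul0mx, mulmx1, mul1mx, addr0, add0r, mulmxN, oppr0).
  by case/eq_block_mx.
by split=> //; exact: mulmx1C.
Qed.

(** Here [kmat 0] is the projection onto the last axis. This form of the condition suits
    [cayley_fix] and [cayley_comm], which transfer linear identities from Y to its curve. *)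
Lemma kmatE (k : mat) : k *m kmat 0 = kmat 0 -> kmat 0 *m k = kmat 0 ->
  k = kmat (ulsubmx k).
Proof.
rewrite -[k]submxK /kmat !mulmx_block block_mxKul.
rewrite !(mulmx0, mul0mx, mulmx1, mul1mx, addr0, add0r).
by move=> /eq_block_mx[_ -> _ ->] /eq_block_mx[_ _ -> _].
Qed.

Lemma U_cayley_near (w : 'M[R]_(n + n)) (a : R) : w^T = - w -> w *m J0 = J0 *m w ->
  \forall t \near (0 : R), U (cayley (a *: kblock w) t).
Proof.
move=> wt wJ.
have sw := kblock_so21 wt.
have := cayley_unit_near (a *: kblock w).
apply: filterS2 (cayley_SO_near (so21Z a sw)) => t SOt ut.
set k := cayley _ t in SOt *.
have k1 : k *m kmat 0 = kmat 0.
  apply: cayley_fix => //.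
  rewrite -scalemxAl /kblock /kmat !mulmx_block.
  rewrite !(mulmx0, mul0mx, addr0, add0r).
  by rewrite [block_mx _ _ _ _]block_mx0 scaler0.
have k2 : kmat 0 *m k = kmat 0.
  rewrite -[RHS]k1; apply/esym/cayley_comm => //.
  rewrite -scalemxAl -scalemxAr /kblock /kmat !mulmx_block.
  by rewrite !(mulmx0, mul0mx, addr0, add0r).
have k3 : k *m kblock J0 = kblock J0 *m k.
  apply: cayley_comm => //.
  rewrite -scalemxAl -scalemxAr /kblock !mulmx_block.
  by rewrite !(mulmx0, mul0mx, addr0, add0r) wJ.
have kE := kmatE k1 k2.
split=> //; exists (ulsubmx k); first exact: kE.
move: k3; rewrite kE /kmat /kblock !mulmx_block !(mulmx0, mul0mx, addr0, add0r).
by rewrite block_mxKul; case/eq_block_mx.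
Qed.

(** The fibre analogue of [derive_SO_eq0]: the curve of diag(w, 0) stays in U(n), so only values on
    the fibre g U(n) matter. *)
Lemma derive_U_eq0 (W : normedModType R) (H : mat -> W) g (w : 'M[R]_(n + n)) :
  w^T = - w -> w *m J0 = J0 *m w -> differentiable H g ->
  (\forall h \near g, forall k, U k -> h = g *m k -> H h = 0) ->
  'D_(g *m kblock w) H g = 0.
Proof.
move=> wt wJ dH H0; rewrite (half_double (kblock w)).
apply: derive_along_cayley => //.
have := cayley_near (2^-1 *: kblock w) H0.
apply: filterS2 (U_cayley_near 2^-1 wt wJ) => t Ut /(_ _ Ut erefl); exact.
Qed.

End Group.

(** * Directional derivatives: expansion in a basis and linear substitutions *)

Section DirectionalDerivatives.
Variable R : realType.
Implicit Types U V W : normedModType R.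

Lemma Ck_differentiable V W (F : V -> W) : Ck 1 F -> forall x, differentiable F x.
Proof. by case. Qed.

Lemma derive_linear V W (F : V -> W) x : differentiable F x ->
  linear (fun v => 'D_v F x).
Proof. by move=> dF a u v; rewrite !deriveE// linearP. Qed.

(** Turns a derivative in a direction that varies with the point into a finite sum of products, to
    which the product rule applies. *)
Lemma derive_delta p q W (F : 'M[R]_(p, q) -> W) x v : differentiable F x ->
  'D_v F x = \sum_i \sum_j v i j *: 'D_(delta_mx i j) F x.
Proof.
move=> dF; rewrite deriveE// {1}[v]matrix_sum_delta linear_sum.
apply: eq_bigr => i _; rewrite linear_sum; apply: eq_bigr => j _.
by rewrite linearZ deriveE.
Qed.

Lemma differentiable_bigsum V W (I : Type) (r : seq I) (F : I -> V -> W) x :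
  (forall i, differentiable (F i) x) ->
  differentiable (fun y => \sum_(i <- r) F i y) x /\
  forall v, 'D_v (fun y => \sum_(i <- r) F i y) x = \sum_(i <- r) 'D_v (F i) x.
Proof.
move=> dF; elim: r => [|i r [dS DS]].
  under eq_fun do rewrite big_nil.
  split=> [|v]; first exact: differentiable_cst.
  by rewrite derive_cst big_nil.
under eq_fun do rewrite big_cons.
split=> [|v]; first exact: differentiableD.
by rewrite big_cons -DS deriveD//; exact: diff_derivable.
Qed.

Lemma differentiable_precomp_linear U V W (T : U -> V) (F : V -> W) x :
  linear T -> continuous T -> differentiable F (T x) ->
  differentiable (F \o T) x /\ forall v, 'D_v (F \o T) x = 'D_(T v) F (T x).
Proof.
move=> Tl Tc dF.
pose L : {linear U -> V} := HB.pack T (GRing.isLinear.Build _ _ _ _ _ Tl).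
have dL : differentiable L x by exact: linear_differentiable.
have dFL : differentiable (F \o L) x by exact: differentiable_comp.
split=> // v.
have dLE : 'd L x = L :> (U -> V) by exact: diff_lin.
by rewrite -[T]/(L : U -> V) deriveE// diff_comp//= dLE deriveE.
Qed.

Lemma Ck_precomp_linear U V W (T : U -> V) k (F : V -> W) :
  linear T -> continuous T -> Ck k F -> Ck k (F \o T).
Proof.
move=> Tl Tc; elim: k F => [|k IH] F.
  by move=> Fc x; apply: continuous_comp; [exact: Tc|exact: Fc].
case=> dF DF; split=> [x|v].
  exact: (differentiable_precomp_linear Tl Tc (dF _)).1.
have -> : (fun x => 'D_v (F \o T) x) = (fun y => 'D_(T v) F y) \o T.
  by apply/funext => x; rewrite (differentiable_precomp_linear Tl Tc (dF _)).2.
exact/IH/DF.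
Qed.

End DirectionalDerivatives.

(** * Derivatives along left-invariant directions *)

Section LeftInvariantCalculus.
Variables (R : realType) (n : nat).
Local Notation mat := (mat R n).
Implicit Types (W : normedModType R) (X Y Z g h : mat).

Lemma mulmxr_linear p q r : forall v, linear ((@mulmx R p q r)^~ v).
Proof. by move=> v a A B; rewrite mulmxDl scalemxAl. Qed.

Lemma mulmx_linear p q r : forall u, linear (@mulmx R p q r u).
Proof. by move=> v a A B; rewrite mulmxDr scalemxAr. Qed.

Lemma mulmx_pair_continuous p q r :
  continuous (fun x : 'M[R]_(p, q) * 'M[R]_(q, r) => x.1 *m x.2).
Proof.
apply: (matrix_bilinear_continuous (B := @mulmx R p q r)).
- exact: mulmx_linear.
- by move=> u; apply: matrix_linear_continuous; exact: mulmx_linear.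
- exact: mulmxr_linear.
Qed.

Lemma scale_linear W : forall a : R, linear ( *:%R a : W -> W).
Proof. by move=> a b u v; rewrite scalerDr !scalerA mulrC. Qed.

Lemma scalel_linear W : forall v : W, linear (( *:%R)^~ v : R -> W).
Proof. by move=> v a b c; rewrite scalerDl scalerA. Qed.

(** The product rule, with the two derivatives of the second-order term exchanged by symmetry so
    that this term cancels after antisymmetrization. *)
Lemma derive_moving_direction W (F : mat -> W) (Y : mat -> mat) g w :
  separated_by_forms W -> (forall k, Ck k F) -> differentiable Y g ->
  'D_w (fun h => 'D_(h *m Y h) F h) g
  = 'D_(w *m Y g + g *m 'D_w Y g) F g + 'D_(g *m Y g) (fun h => 'D_w F h) g.
Proof.
move=> sepW CF dY.
have dF h : differentiable F h by exact: Ck_differentiable (CF 1%N) h.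
have dDF v h : differentiable (fun h => 'D_v F h) h by exact: ((CF 2).2 v).1.
have did : differentiable (id : mat -> mat) g by exact: ex_diff.
have [dhY DhY] := differentiable_bilinear_comp (@mulmx_linear _ _ _)
  (@mulmxr_linear _ _ _) (@mulmx_pair_continuous _ _ _) did dY.
pose c i j (M : mat) := M i j.
have cl i j : linear (c i j) by move=> a A B; rewrite /c !mxE.
have cc i j : continuous (c i j) by exact: coord_continuous.
have -> : (fun h => 'D_(h *m Y h) F h)
  = (fun h => \sum_i \sum_j (h *m Y h) i j *: 'D_(delta_mx i j) F h).
  by apply/funext => h; rewrite -derive_delta.
have dc i j := differentiable_linear_comp (cl i j) (cc i j) dhY.
have dterm i j := differentiable_bilinear_comp (@scale_linear W)
  (@scalel_linear W) (@scale_continuous _ _) (dc i j).1 (dDF (delta_mx i j) g).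
have dsum i := differentiable_bigsum (index_enum _) (fun j => (dterm i j).1).
rewrite (differentiable_bigsum (index_enum _) (fun i => (dsum i).1)).2.
rewrite (derive_delta _ (dF g)) (derive_delta _ (dDF w g)) -big_split.
apply: eq_bigr => i _; rewrite (dsum i).2 -big_split; apply: eq_bigr => j _ /=.
by rewrite (dterm i j).2 (dc i j).2 DhY /c derive_id (derive_comm _ _ _ sepW).
Qed.

(** The second-order terms cancel. Differentiating the factor h of [h *m Y h] gives g X Y, hence the
    matrix commutator; differentiating the coefficients gives the other two terms. *)
Lemma derive_moving_comm W (F : mat -> W) (X Y : mat -> mat) g :
  separated_by_forms W -> (forall k, Ck k F) ->
  differentiable X g -> differentiable Y g ->
  'D_(g *m X g) (fun h => 'D_(h *m Y h) F h) g
  - 'D_(g *m Y g) (fun h => 'D_(h *m X h) F h) g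
  = 'D_(g *m (br (X g) (Y g) + 'D_(g *m X g) Y g - 'D_(g *m Y g) X g)) F g.
Proof.
move=> sepW CF dX dY; rewrite (derive_moving_direction _ sepW CF dX).
rewrite (derive_moving_direction _ sepW CF dY).
rewrite (derive_comm g (g *m Y g) (g *m X g) sepW (CF 2)).
have addrKK (a b z : W) : a + z - (b + z) = a - b.
  by rewrite opprD addrACA subrr addr0.
rewrite addrKK.
have dF : differentiable F g by exact: Ck_differentiable (CF 1%N) g.
move: ('D_(g *m X g) Y g) ('D_(g *m Y g) X g) => DY DX.
rewrite !(deriveE _ dF) -linearB/=; congr ('d _ _ _).
rewrite mulmxBr mulmxDr /br mulmxBr !mulmxA opprD.
by rewrite addrACA addrA.
Qed.

End LeftInvariantCalculus.

(** * Smooth functions on the group and the calculus of [der] *)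

Section SmoothFunctions.
Variables (R : realType) (n : nat).
Local Notation mat := (mat R n).
Implicit Types (V W : normedModType R) (X Y Z g h : mat).

Lemma smooth_ext_near W (f : mat -> W) g F : smooth_ext f g F ->
  \forall h \near g, smooth_ext f h F.
Proof.
by move=> [CF fF]; have := nbhs_interior fF; apply: filterS => h Hh; split.
Qed.

Lemma smooth_ext_val W (f : mat -> W) g F : smooth_ext f g F -> SO g -> f g = F g.
Proof. by case=> _ /nbhs_singleton. Qed.

Lemma smooth_ext_differentiable W (f : mat -> W) g F :
  smooth_ext f g F -> forall h, differentiable F h.
Proof. by case=> CF _; exact: Ck_differentiable (CF 1%N). Qed.

Lemma derE W (f : mat -> W) g X F : SO g -> so21 X -> smooth_ext f g F ->
  der f g X = 'D_(g *m X) F g.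
Proof.
move=> SOg sX eF; rewrite /der.
have : smooth_ext f g (xget f [set F | smooth_ext f g F]) by apply: xgetPex; exists F.
move: (xget _ _) => G eG.
have dG := smooth_ext_differentiable eG g.
have dF := smooth_ext_differentiable eF g.
apply/eqP; rewrite -subr_eq0 -deriveB; try exact: diff_derivable.
apply/eqP/derive_SO_eq0 => //; first exact: differentiableB.
have [[_ fG] [_ fF]] := (eG, eF).
by apply: filterS2 fG fF => h Gh Fh SOh; rewrite !fctE -Gh// -Fh// subrr.
Qed.

Lemma smooth_ext_linear V W (L : V -> W) (f : mat -> V) g F :
  linear L -> continuous L -> smooth_ext f g F ->
  smooth_ext (fun h => L (f h)) g (fun h => L (F h)).
Proof.
move=> Ll Lc [CF fF]; split=> [k|]; first exact: (Ck_comp_linear Ll Lc (CF k)).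
by apply: filterS fF => h fh SOh; rewrite fh.
Qed.

Lemma smooth_ext_bilinear V (V' : normedModType R) W (B : V -> V' -> W) (f : mat -> V)
    (f' : mat -> V') g F F' :
  (forall u, linear (B u)) -> (forall v, linear (B ^~ v)) ->
  continuous (fun p : V * V' => B p.1 p.2) ->
  smooth_ext f g F -> smooth_ext f' g F' ->
  smooth_ext (fun h => B (f h) (f' h)) g (fun h => B (F h) (F' h)).
Proof.
move=> Br Bl Bc [CF fF] [CF' fF']; split=> [k|]; first exact: Ck_bilinear.
by apply: filterS2 fF fF' => h fh fh' SOh; rewrite fh// fh'.
Qed.

Lemma smooth_extD W (f f' : mat -> W) g F F' :
  smooth_ext f g F -> smooth_ext f' g F' ->
  smooth_ext (fun h => f h + f' h) g (fun h => F h + F' h).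
Proof.
move=> [CF fF] [CF' fF']; split=> [k|]; first exact: CkD.
by apply: filterS2 fF fF' => h fh fh' SOh; rewrite fh// fh'.
Qed.

Lemma smooth_ext_precomp W (T : mat -> mat) (f : mat -> W) g F :
  linear T -> continuous T -> (forall h, SO h -> SO (T h)) ->
  smooth_ext f (T g) F -> smooth_ext (fun h => f (T h)) g (fun h => F (T h)).
Proof.
move=> Tl Tc TSO [CF fF]; split=> [k|]; first exact: (Ck_precomp_linear Tl Tc (CF k)).
have fFT : \forall h \near g, SO (T h) -> f (T h) = F (T h) by exact: Tc fF.
by apply: filterS fFT => h fh SOh; exact/fh/TSO.
Qed.

Lemma smooth_ext_eq W (f f' : mat -> W) g F :
  (forall h, SO h -> f h = f' h) -> smooth_ext f g F -> smooth_ext f' g F.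
Proof.
move=> ff' [CF fF]; split=> //; apply: filterS fF => h fh SOh.
by rewrite -ff'// fh.
Qed.

(** Exhibits an extension of the derivative itself, so that [der] can be iterated. One F serves at
    all points near g, by [smooth_ext_near]. *)
Lemma smooth_ext_der W (f : mat -> W) (x : mat -> mat) g F (X : mat -> mat) :
  (forall h, SO h -> so21 (x h)) -> smooth_ext f g F -> smooth_ext x g X ->
  smooth_ext (fun h => der f h (x h)) g (fun h => 'D_(h *m X h) F h).
Proof.
move=> sx eF [CX xX].
have dF := smooth_ext_differentiable eF.
split=> [k|].
  have -> : (fun h => 'D_(h *m X h) F h)
    = (fun h => \sum_i \sum_j (h *m X h) i j *: 'D_(delta_mx i j) F h).
    by apply/funext => h; rewrite -derive_delta.
  apply: Ck_sum => i; apply: Ck_sum => j.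
  apply: (Ck_bilinear (B := fun (a : R) (u : W) => a *: u)).
  - exact: scale_linear.
  - exact: scalel_linear.
  - exact: scale_continuous.
  - apply: (@Ck_comp_linear _ _ _ _ (fun M : mat => M i j) _ (fun h => h *m X h)).
    + by move=> a A B; rewrite !mxE.
    + exact: coord_continuous.
    + apply: (Ck_bilinear (B := @mulmx R _ _ _)) => //.
      * exact: mulmx_linear.
      * exact: mulmxr_linear.
      * exact: mulmx_pair_continuous.
      * by apply: (@Ck_linear _ _ _ _ id) => // M; exact: cvg_id.
  - by have [_] := eF.1 k.+1; exact.
apply: filterS2 (smooth_ext_near eF) xX => h eFh xh SOh.
by rewrite (derE SOh (sx h SOh) eFh) xh.
Qed.

Lemma smooth_der W (f : mat -> W) (x : mat -> mat) :
  (forall h, SO h -> so21 (x h)) -> smooth f -> smooth x ->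
  smooth (fun h => der f h (x h)).
Proof.
move=> sx sf sx' g SOg; have [F eF] := sf g SOg; have [X eX] := sx' g SOg.
by exists (fun h => 'D_(h *m X h) F h); exact: smooth_ext_der.
Qed.

Lemma smooth_linear V W (L : V -> W) (f : mat -> V) :
  linear L -> continuous L -> smooth f -> smooth (fun h => L (f h)).
Proof.
move=> Ll Lc sf g SOg; have [F eF] := sf g SOg.
by exists (fun h => L (F h)); exact: smooth_ext_linear.
Qed.

Lemma smooth_bilinear V (V' : normedModType R) W (B : V -> V' -> W)
    (f : mat -> V) (f' : mat -> V') :
  (forall u, linear (B u)) -> (forall v, linear (B ^~ v)) ->
  continuous (fun p : V * V' => B p.1 p.2) ->
  smooth f -> smooth f' -> smooth (fun h => B (f h) (f' h)).
Proof.
move=> Br Bl Bc sf sf' g SOg; have [F eF] := sf g SOg; have [F' eF'] := sf' g SOg.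
by exists (fun h => B (F h) (F' h)); exact: smooth_ext_bilinear.
Qed.

Lemma smoothD W (f f' : mat -> W) : smooth f -> smooth f' ->
  smooth (fun h => f h + f' h).
Proof.
move=> sf sf' g SOg; have [F eF] := sf g SOg; have [F' eF'] := sf' g SOg.
by exists (fun h => F h + F' h); exact: smooth_extD.
Qed.

Lemma smooth_cst W (a : W) : smooth (fun _ : mat => a).
Proof.
move=> g _; exists (cst a); split=> [k|]; first exact: Ck_cst.
by apply: filterE.
Qed.

Lemma der_linear W (f : mat -> W) g (a : R) X Y : smooth f -> SO g ->
  so21 X -> so21 Y -> der f g (a *: X + Y) = a *: der f g X + der f g Y.
Proof.
move=> sf SOg sX sY; have [F eF] := sf g SOg.
have sXY := so21D (so21Z a sX) sY.
rewrite !(derE _ _ eF)// mulmxDr -scalemxAr.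
exact: (derive_linear (smooth_ext_differentiable eF g)).
Qed.

Lemma derB W (f : mat -> W) g X Y : smooth f -> SO g ->
  so21 X -> so21 Y -> der f g (X - Y) = der f g X - der f g Y.
Proof.
move=> sf SOg sX sY.
by rewrite addrC -scaleN1r der_linear// scaleN1r addrC.
Qed.

Lemma der_comp_linear V W (L : V -> W) (f : mat -> V) g X :
  linear L -> continuous L -> smooth f -> SO g -> so21 X ->
  der (fun h => L (f h)) g X = L (der f g X).
Proof.
move=> Ll Lc sf SOg sX; have [F eF] := sf g SOg.
rewrite (derE SOg sX (smooth_ext_linear Ll Lc eF)) (derE SOg sX eF).
exact: (differentiable_linear_comp Ll Lc (smooth_ext_differentiable eF g)).2.
Qed.

Lemma der_bilinear V (V' : normedModType R) W (B : V -> V' -> W)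
    (f : mat -> V) (f' : mat -> V') g X :
  (forall u, linear (B u)) -> (forall v, linear (B ^~ v)) ->
  continuous (fun p : V * V' => B p.1 p.2) ->
  smooth f -> smooth f' -> SO g -> so21 X ->
  der (fun h => B (f h) (f' h)) g X
  = B (der f g X) (f' g) + B (f g) (der f' g X).
Proof.
move=> Br Bl Bc sf sf' SOg sX; have [F eF] := sf g SOg; have [F' eF'] := sf' g SOg.
rewrite (derE SOg sX (smooth_ext_bilinear Br Bl Bc eF eF')).
rewrite (derE SOg sX eF) (derE SOg sX eF').
rewrite (smooth_ext_val eF)// (smooth_ext_val eF')//.
have dF := smooth_ext_differentiable eF g.
have dF' := smooth_ext_differentiable eF' g.
exact: (differentiable_bilinear_comp Br Bl Bc dF dF').2.
Qed.

Lemma derD W (f f' : mat -> W) g X : smooth f -> smooth f' -> SO g -> so21 X ->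
  der (fun h => f h + f' h) g X = der f g X + der f' g X.
Proof.
move=> sf sf' SOg sX; have [F eF] := sf g SOg; have [F' eF'] := sf' g SOg.
rewrite (derE SOg sX (smooth_extD eF eF')) (derE SOg sX eF) (derE SOg sX eF').
have dF := smooth_ext_differentiable eF g.
have dF' := smooth_ext_differentiable eF' g.
by rewrite deriveD//; exact: diff_derivable.
Qed.

Lemma der_eq W (f f' : mat -> W) g X : (forall h, SO h -> f h = f' h) ->
  smooth f -> SO g -> so21 X -> der f g X = der f' g X.
Proof.
move=> ff' sf SOg sX; have [F eF] := sf g SOg.
by rewrite (derE SOg sX eF) (derE SOg sX (smooth_ext_eq ff' eF)).
Qed.

(** Meant for translations: a left translation keeps the direction, a right translation by k changes
    it by conjugation. *)
Lemma der_precomp W (T : mat -> mat) (f : mat -> W) g X Y :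
  linear T -> continuous T -> (forall h, SO h -> SO (T h)) -> smooth f ->
  SO g -> so21 X -> so21 Y -> T (g *m X) = T g *m Y ->
  der (fun h => f (T h)) g X = der f (T g) Y.
Proof.
move=> Tl Tc TSO sf SOg sX sY TX.
have [F eF] := sf (T g) (TSO g SOg).
rewrite (derE SOg sX (smooth_ext_precomp Tl Tc TSO eF)) (derE (TSO _ SOg) sY eF) -TX.
have dF := smooth_ext_differentiable eF (T g).
exact: (differentiable_precomp_linear Tl Tc dF).2.
Qed.

Lemma der_comm W (f : mat -> W) (x y : mat -> mat) g :
  separated_by_forms W -> smooth f -> smooth x -> smooth y ->
  (forall h, SO h -> so21 (x h)) -> (forall h, SO h -> so21 (y h)) -> SO g ->
  so21 (der y g (x g)) -> so21 (der x g (y g)) ->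
  der (fun h => der f h (y h)) g (x g) - der (fun h => der f h (x h)) g (y g)
  = der f g (br (x g) (y g) + der y g (x g) - der x g (y g)).
Proof.
move=> sepW sf smx smy sx sy SOg sDy sDx.
have [F eF] := sf g SOg; have [X eX] := smx g SOg; have [Y eY] := smy g SOg.
have sxg := sx g SOg; have syg := sy g SOg.
rewrite (derE SOg sxg (smooth_ext_der sy eF eY)).
rewrite (derE SOg syg (smooth_ext_der sx eF eX)).
have sbr := so21D (so21D (so21_br sxg syg) sDy) (so21N sDx).
rewrite (derE SOg sbr eF) (derE SOg sxg eY) (derE SOg syg eX).
rewrite (smooth_ext_val eX)// (smooth_ext_val eY)//.
apply: derive_moving_comm => //; first exact: eF.1.
  exact: (smooth_ext_differentiable eX).
exact: (smooth_ext_differentiable eY).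
Qed.

End SmoothFunctions.

(** * Vector fields and the canonical connection *)

Section VectorFields.
Variables (R : realType) (n : nat).
Local Notation mat := (mat R n).
Local Notation J0 := (J0 R n).
Implicit Types (X Y Z g h k : mat) (x y z : mat -> mat) (u : 'cV[R]_(n + n)).

Lemma br_linearl Y : linear (fun X : mat => br X Y).
Proof.
move=> a X Z; rewrite /br mulmxDl mulmxDr -scalemxAl -scalemxAr opprD addrACA.
by rewrite scalerBr.
Qed.

Lemma br_linearr X : linear (fun Y : mat => br X Y).
Proof.
move=> a Y Z; rewrite /br mulmxDl mulmxDr -scalemxAl -scalemxAr opprD addrACA.
by rewrite scalerBr.
Qed.

Lemma so21_conj k X : SO k -> so21 X -> so21 (k *m X *m invmx k).
Proof.
move=> SOk sX; have uk := SO_unit SOk.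
have kO : k^T *m lorentz R n *m k = lorentz R n by exact/OquadP/SO_sub.
have e1 : k^T *m lorentz R n = lorentz R n *m invmx k.
  by rewrite -[in RHS]kO mulmxK.
have e2 : (invmx k)^T *m lorentz R n = lorentz R n *m k.
  by rewrite -[in LHS]kO trmx_inv -!mulmxA mulKmx ?unitmx_tr.
rewrite /so21 !trmx_mul -!mulmxA e1 [X^T *m _]mulmxA sX mulNmx mulmxN.
by rewrite -!mulmxA [(invmx k)^T *m _]mulmxA e2 !mulmxA.
Qed.

Lemma invmx_kmat (k0 : 'M[R]_(n + n)) : k0^T *m k0 = 1%:M ->
  invmx (kmat k0) = kmat k0^T.
Proof.
move=> kk; have kK : kmat k0^T *m kmat k0 = 1%:M.
  rewrite /kmat mulmx_block !(mulmx0, mul0mx, mulmx1, mul1mx, addr0, add0r) kk.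
  by rewrite -scalar_mx_block.
by rewrite -[LHS]mul1mx -kK mulmxK//; case/mulmx1_unit: kK.
Qed.

Lemma conj_kmat (k0 : 'M[R]_(n + n)) X :
  kmat k0^T *m X *m kmat k0
  = block_mx (k0^T *m ulsubmx X *m k0) (k0^T *m ursubmx X)
             (dlsubmx X *m k0) (drsubmx X).
Proof.
rewrite -{1}[X]submxK /kmat !mulmx_block.
by rewrite !(mulmx0, mul0mx, mulmx1, mul1mx, addr0, add0r).
Qed.

Lemma conj_m_mx (k0 : 'M[R]_(n + n)) A u :
  kmat k0^T *m m_mx A u *m kmat k0 = m_mx (k0^T *m A *m k0) (k0^T *m u).
Proof.
rewrite conj_kmat /m_mx block_mxKul block_mxKur block_mxKdl block_mxKdr.
by rewrite trmx_mul trmxK.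
Qed.

Lemma mproj_conj k X : U k ->
  mproj (invmx k *m X *m k) = invmx k *m mproj X *m k.
Proof.
move=> /U_kmat[k0 [-> kk kk' kJ]]; rewrite invmx_kmat// /mproj conj_m_mx.
rewrite conj_kmat block_mxKul block_mxKur; congr m_mx.
have kJt : k0^T *m J0 = J0 *m k0^T.
  by apply: trmx_inj; rewrite !trmx_mul trmxK tr_J0 mulNmx mulmxN kJ.
rewrite /mpart -scalemxAr -scalemxAl; congr (_ *: _).
have -> : (k0^T *m ulsubmx X *m k0)^T = k0^T *m (ulsubmx X)^T *m k0.
  by rewrite !trmx_mul trmxK mulmxA.
rewrite -mulmxBl -mulmxBr; move: (ulsubmx X - _) => S.
by rewrite mulmxDr mulmxDl !mulmxA kJt -!mulmxA kJ.
Qed.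

Lemma Jm_conj k X : U k -> Jm (invmx k *m X *m k) = invmx k *m Jm X *m k.
Proof.
move=> /U_kmat[k0 [-> kk kk' kJ]]; rewrite invmx_kmat// /Jm conj_m_mx.
have kJt : k0^T *m J0 = J0 *m k0^T.
  by apply: trmx_inj; rewrite !trmx_mul trmxK tr_J0 mulNmx mulmxN kJ.
rewrite conj_kmat block_mxKul block_mxKur; congr m_mx.
  by rewrite -!mulmxA kJ.
by rewrite !mulmxA kJt.
Qed.

Lemma U_unit k : U k -> k \in unitmx.
Proof. by case=> /SO_unit. Qed.

Lemma br_conj k X Y : U k ->
  br (invmx k *m X *m k) (invmx k *m Y *m k) = invmx k *m br X Y *m k.
Proof.
move=> /U_unit uk; rewrite /br mulmxBr mulmxBl.
have e A B : invmx k *m A *m k *m (invmx k *m B *m k) = invmx k *m (A *m B) *m k.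
  by rewrite !mulmxA mulmxK.
by rewrite !e.
Qed.

Variable Gamma : set mat.
Hypothesis Gamma_SO : Gamma `<=` @SO R n.

Lemma vf_so x : vector_field Gamma x -> forall g, SO g -> so21 (x g).
Proof. by move=> vx g SOg; apply: m_so21; exact: vf_m vx g SOg. Qed.

Lemma Jm_continuous : continuous (@Jm R n).
Proof. by apply: matrix_linear_continuous; exact: Jm_linear. Qed.

Lemma mproj_continuous : continuous (@mproj R n).
Proof. by apply: matrix_linear_continuous; exact: mproj_linear. Qed.

(** Being m-valued means being fixed by the linear map [mproj], and differentiation commutes with
    linear maps. *)
Lemma der_m x g X : vector_field Gamma x -> SO g -> so21 X ->
  m_space (der x g X).
Proof.
move=> vx SOg sX; apply/m_space_mproj.
have <- := der_comp_linear (@mproj_linear R n) mproj_continuous (vf_smooth vx) SOg sX.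
apply/esym/der_eq => //; first last.
  exact: vf_smooth vx.
by move=> h SOh; rewrite mproj_id//; exact: vf_m vx h SOh.
Qed.

Lemma der_left (W : normedModType R) (f : mat -> W) a g X :
  (forall h, SO h -> f (a *m h) = f h) -> smooth f ->
  SO a -> SO g -> so21 X -> der f (a *m g) X = der f g X.
Proof.
move=> fa sf SOa SOg sX.
rewrite -(@der_precomp _ _ _ (mulmx a) _ g X X)//.
- rewrite (der_eq (f := f) (f' := fun h => f (a *m h)))//.
  by move=> h SOh; rewrite fa.
- exact: mulmx_linear.
- exact: mulmx_continuous.
- by move=> h; exact: SO_mul.
- by rewrite mulmxA.
Qed.

Lemma conj_linear k : linear (fun X => invmx k *m X *m k).
Proof. by move=> a X Y; rewrite mulmxDr mulmxDl -scalemxAr -scalemxAl. Qed.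

Lemma der_right y g k X : vector_field Gamma y -> SO g -> U k -> so21 X ->
  der y (g *m k) X = invmx k *m der y g (k *m X *m invmx k) *m k.
Proof.
move=> vy SOg Uk sX; have [SOk _] := Uk; have sy := vf_smooth vy.
have sX' := so21_conj SOk sX.
rewrite -(@der_precomp _ _ _ (mulmx^~ k) _ g (k *m X *m invmx k) X)//.
- rewrite (der_eq (f := fun h => y (h *m k)) (f' := fun h => invmx k *m y h *m k))//.
  + rewrite (der_comp_linear (conj_linear k))//.
    exact/matrix_linear_continuous/conj_linear.
  + by move=> h SOh; exact: vf_right vy h k SOh Uk.
  + move=> h SOh; have [F eF] := sy (h *m k) (SO_mul SOh SOk).
    exists (fun h => F (h *m k)).
    apply: (@smooth_ext_precomp _ _ _ (mulmx^~ k) y h F) => //.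
    * exact: mulmxr_linear.
    * exact/matrix_linear_continuous/mulmxr_linear.
    * by move=> h' SOh'; exact: SO_mul.
- exact: mulmxr_linear.
- exact/matrix_linear_continuous/mulmxr_linear.
- by move=> h SOh; exact: SO_mul.
- by rewrite -!mulmxA mulVmx ?mulmx1//; exact: SO_unit.
Qed.

Definition nabla x y : mat -> mat := fun g => der y g (x g).

Lemma nabla_vf x y : vector_field Gamma x -> vector_field Gamma y ->
  vector_field Gamma (nabla x y).
Proof.
move=> vx vy; have sx := vf_so vx; split.
- apply: smooth_der => //; [exact: vf_smooth vy|exact: vf_smooth vx].
- by move=> g SOg; apply: der_m => //; exact: sx.
- move=> a g Ga SOg; rewrite /nabla (vf_left vx Ga SOg).
  apply: der_left => //; [|exact: vf_smooth vy|exact: Gamma_SO|exact: sx].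
  by move=> h SOh; exact: vf_left vy a h Ga SOh.
- move=> g k SOg Uk; rewrite /nabla (vf_right vx SOg Uk).
  have uk := U_unit Uk; have [SOk _] := Uk.
  have sc : so21 (invmx k *m x g *m k).
    by rewrite -(vf_right vx SOg Uk); apply: sx; exact: SO_mul.
  have xE : k *m (invmx k *m x g *m k) *m invmx k = x g.
    by rewrite -!mulmxA mulmxV// mulmx1 mulKVmx.
  by rewrite (der_right vy SOg Uk sc) xE.
Qed.

Definition torsion_bracket x y : mat -> mat := fun g => mproj (br (x g) (y g)).

Lemma torsion_bracket_vf x y : vector_field Gamma x -> vector_field Gamma y ->
  vector_field Gamma (torsion_bracket x y).
Proof.
move=> vx vy; split.
- have mbr X : linear (fun Y => mproj (br X Y)).
    by move=> a Y Z; rewrite br_linearr mproj_linear.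
  have mbl Y : linear (fun X => mproj (br X Y)).
    by move=> a X Z; rewrite br_linearl mproj_linear.
  apply: (smooth_bilinear (B := fun X Y => mproj (br X Y))) => //.
  + apply: (matrix_bilinear_continuous (B := fun X Y => mproj (br X Y))) => //.
    by move=> X; exact: matrix_linear_continuous.
  + exact: vf_smooth vx.
  + exact: vf_smooth vy.
- by move=> g SOg; exact: mproj_m.
- move=> a g Ga SOg.
  by rewrite /torsion_bracket (vf_left vx Ga SOg) (vf_left vy Ga SOg).
- move=> g k SOg Uk; rewrite /torsion_bracket (vf_right vx SOg Uk) (vf_right vy SOg Uk).
  by rewrite br_conj// mproj_conj.
Qed.

Lemma vfD x y : vector_field Gamma x -> vector_field Gamma y ->
  vector_field Gamma (fun g => x g + y g).
Proof.
move=> vx vy; split.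
- by apply: smoothD; [exact: vf_smooth vx|exact: vf_smooth vy].
- by move=> g SOg; apply: mspaceD; [exact: vf_m vx g SOg|exact: vf_m vy g SOg].
- by move=> a g Ga SOg; rewrite (vf_left vx Ga SOg) (vf_left vy Ga SOg).
- move=> g k SOg Uk.
  by rewrite (vf_right vx SOg Uk) (vf_right vy SOg Uk) mulmxDr mulmxDl.
Qed.

Lemma vf_linear x (L : mat -> mat) : linear L ->
  (forall X, m_space X -> m_space (L X)) ->
  (forall k X, U k -> L (invmx k *m X *m k) = invmx k *m L X *m k) ->
  vector_field Gamma x -> vector_field Gamma (fun g => L (x g)).
Proof.
move=> Ll Lm LU vx; split.
- apply: (smooth_linear Ll); last exact: vf_smooth vx.
  exact: matrix_linear_continuous.
- by move=> g SOg; apply: Lm; exact: vf_m vx g SOg.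
- by move=> a g Ga SOg; rewrite (vf_left vx Ga SOg).
- by move=> g k SOg Uk; rewrite (vf_right vx SOg Uk) LU.
Qed.

Lemma vfN x : vector_field Gamma x -> vector_field Gamma (fun g => - x g).
Proof.
apply: vf_linear.
- by move=> a X Y; rewrite opprD scalerN.
- by move=> X mX; rewrite -scaleN1r; exact: mspaceZ.
- by move=> k X _; rewrite mulmxN mulNmx.
Qed.

(** The explicit value of the Lie bracket: the m-part of the bracket on the group. In this form the
    torsion of [nabla] is visibly - [x, y]_m. *)
Definition ebr x y : mat -> mat :=
  fun g => nabla x y g + (- nabla y x g) + torsion_bracket x y g.

Lemma ebr_vf x y : vector_field Gamma x -> vector_field Gamma y ->
  vector_field Gamma (ebr x y).
Proof.
move=> vx vy; apply: vfD; last exact: torsion_bracket_vf.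
by apply: vfD; [exact: nabla_vf|exact/vfN/nabla_vf].
Qed.

Lemma br_nabla x y g : br (x g) (y g) + nabla x y g - nabla y x g
  = ebr x y g + (br (x g) (y g) - mproj (br (x g) (y g))).
Proof.
rewrite /ebr /torsion_bracket -[RHS]addrA [mproj _ + _]addrC subrK.
by rewrite [RHS]addrC addrA.
Qed.

(** The commutator formula behind both the bracket and the curvature. The values of f are left
    general because it is used for invariant scalar functions and for vector fields. *)
Lemma der_comm_vf (W : normedModType R) (f : mat -> W) x y g :
  separated_by_forms W -> smooth f ->
  vector_field Gamma x -> vector_field Gamma y -> SO g ->
  der (fun h => der f h (y h)) g (x g) - der (fun h => der f h (x h)) g (y g)
  = der f g (ebr x y g) + der f g (br (x g) (y g) - mproj (br (x g) (y g))).
Proof.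
move=> sepW sf vx vy SOg.
have [sx sy] := (vf_so vx, vf_so vy).
have se := vf_so (ebr_vf vx vy) SOg.
have sk : so21 (br (x g) (y g) - mproj (br (x g) (y g))).
  by apply: so21D; [exact: so21_br (sx g SOg) (sy g SOg)|exact/so21N/m_so21/mproj_m].
have := der_linear 1 sf SOg se sk; rewrite !scale1r => <-; rewrite -br_nabla.
have sxy := vf_so (nabla_vf vx vy) SOg; have syx := vf_so (nabla_vf vy vx) SOg.
exact: (der_comm sepW sf (vf_smooth vx) (vf_smooth vy) sx sy SOg sxy syx).
Qed.

Lemma der_U_fun (f : mat -> R) g (w : 'M[R]_(n + n)) :
  invariant_function [set 1%:M] f -> w^T = - w -> w *m J0 = J0 *m w ->
  so21 (kblock w) -> SO g -> der f g (kblock w) = 0.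
Proof.
move=> fi wt wJ sw SOg; have [F eF] := fun_smooth fi SOg.
rewrite (derE SOg sw eF).
have dF := smooth_ext_differentiable eF g.
(* Subtracting the value at g gives a function that vanishes on the fibre. *)
have -> : 'D_(g *m kblock w) F g = 'D_(g *m kblock w) (F - cst (f g)) g.
  rewrite deriveB ?derive_cst ?subr0//; exact: diff_derivable.
apply: derive_U_eq0 => //; first exact: differentiableB.
have [_ fF] := eF; apply: filterS fF => h fh k Uk hE.
have [SOk _] := Uk.
have SOh : SO h by rewrite hE; exact: SO_mul.
by rewrite !fctE -fh// hE (fun_right fi)// subrr.
Qed.

(** Infinitesimal form of equivariance, written as k z(g k) = z(g) k, so that no inverse of k is
    differentiated. *)
Lemma der_U_vf z g (w : 'M[R]_(n + n)) :
  vector_field Gamma z -> w^T = - w -> w *m J0 = J0 *m w ->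
  so21 (kblock w) -> SO g -> der z g (kblock w) = - br (kblock w) (z g).
Proof.
move=> vz wt wJ sw SOg; have [F eF] := vf_smooth vz SOg.
have ug := SO_unit SOg.
have dF := smooth_ext_differentiable eF g.
(* On the fibre, where h = g k, [A h] is k; this extends k linearly to all matrices. *)
pose A h := invmx g *m h.
pose B h := F g *m A h.
have Al : linear A by exact: mulmx_linear.
have Bl : linear B by move=> a X Y; rewrite /B Al mulmxDr -scalemxAr.
have did : differentiable (id : mat -> mat) g by exact: ex_diff.
have [dA DA] := differentiable_linear_comp Al (matrix_linear_continuous Al) did.
have [dB DB] := differentiable_linear_comp Bl (matrix_linear_continuous Bl) did.
have [dAF DAF] := differentiable_bilinear_comp (@mulmx_linear _ _ _ _)
  (@mulmxr_linear _ _ _ _) (@mulmx_pair_continuous _ _ _ _) dA dF.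
have := @derive_U_eq0 R n mat (fun h => A h *m F h - B h) g w wt wJ.
rewrite deriveB; try exact: diff_derivable.
rewrite DAF DA DB derive_id /B /A /= mulKmx// mulVmx// mul1mx => H.
rewrite (derE SOg sw eF) /br (smooth_ext_val eF SOg) opprB.
apply/eqP; rewrite -subr_eq0 opprB addrA [_ + _ *m _]addrC.
apply/eqP; apply: H; first exact: (differentiableB dAF dB).
have [_ fF] := eF; apply: filterS fF => h fh k Uk hE.
have [SOk _] := Uk.
have SOh : SO h by rewrite hE; exact: SO_mul.
rewrite -fh// hE mulKmx// (vf_right vz SOg Uk) -(smooth_ext_val eF SOg).
by rewrite !mulmxA mulmxV ?U_unit// mul1mx subrr.
Qed.

End VectorFields.

(** * The Lie bracket and the curvature *)

Section LieBracket.
Variables (R : realType) (n : nat).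
Local Notation mat := (mat R n).
Local Notation J0 := (J0 R n).
Implicit Types (X Y Z g h : mat) (x y z : mat -> mat).

(* On SO(2n,1), h^T = lorentz h^-1 lorentz, so this is, up to a factor [lorentz],
   the adjoint orbit of diag(J0, 0): its entries are U(n)-invariant and separate
   the directions in m. *)
Definition J0_orbit h : mat := h *m kblock J0 *m h^T.

Definition test_fun i j h : R := J0_orbit h i j.

Lemma tr_linear p q : linear (@trmx R p q).
Proof. by move=> a A B; rewrite linearP. Qed.

Lemma J0_orbit_smooth : (forall k, Ck k J0_orbit) /\
  forall g v, 'D_v J0_orbit g = v *m kblock J0 *m g^T + g *m kblock J0 *m v^T.
Proof.
have Ckid k : Ck k (id : mat -> mat).
  by apply: (@Ck_linear _ _ _ _ id) => // M; exact: cvg_id.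
have rl : linear (mulmx^~ (kblock J0) : mat -> mat) by exact: mulmxr_linear.
have rc := matrix_linear_continuous rl.
have tl := @tr_linear (n + n + 1) (n + n + 1).
have tc := matrix_linear_continuous tl.
split=> [k|g v].
  apply: (Ck_bilinear (B := @mulmx R _ _ _)).
  - exact: mulmx_linear.
  - exact: mulmxr_linear.
  - exact: mulmx_pair_continuous.
  - exact: (Ck_comp_linear rl rc (Ckid k)).
  - exact: (Ck_comp_linear tl tc (Ckid k)).
have did : differentiable (id : mat -> mat) g by exact: ex_diff.
have [d1 D1] := differentiable_linear_comp rl rc did.
have [d2 D2] := differentiable_linear_comp tl tc did.
rewrite /J0_orbit (differentiable_bilinear_comp (@mulmx_linear _ _ _ _)
  (@mulmxr_linear _ _ _ _) (@mulmx_pair_continuous _ _ _ _) d1 d2).2.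
by rewrite D1 D2 derive_id.
Qed.

Lemma coord_linear i j : linear (fun M : mat => M i j).
Proof. by move=> a A B; rewrite !mxE. Qed.

Lemma test_fun_ext i j g : smooth_ext (test_fun i j) g (test_fun i j).
Proof.
split=> [k|]; last by apply: filterE.
apply: (@Ck_comp_linear _ _ _ _ (fun M : mat => M i j) k J0_orbit).
- exact: coord_linear.
- exact: coord_continuous.
- exact: J0_orbit_smooth.1.
Qed.

Lemma test_fun_invariant i j : invariant_function [set 1%:M] (test_fun i j).
Proof.
split.
- by move=> g _; exists (test_fun i j); exact: test_fun_ext.
- by move=> a g -> _; rewrite mul1mx.
move=> g k _ /U_kmat[k0 [-> kk kk' kJ]]; congr (fun_of_matrix _ i j).
rewrite /J0_orbit trmx_mul -!mulmxA; congr (_ *m _).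
rewrite !mulmxA; congr (_ *m _).
rewrite /kmat /kblock tr_block_mx !mulmx_block !trmx0 trmx1.
rewrite !(mulmx0, mul0mx, mulmx1, mul1mx, addr0, add0r).
by rewrite kJ -mulmxA kk' mulmx1.
Qed.

Lemma der_test_fun i j g X : SO g -> so21 X ->
  der (test_fun i j) g X
  = (g *m (X *m kblock J0 + kblock J0 *m X^T) *m g^T) i j.
Proof.
move=> SOg sX; rewrite (derE SOg sX (test_fun_ext i j g)).
have dO : differentiable J0_orbit g.
  exact: Ck_differentiable (J0_orbit_smooth.1 1%N) g.
have cc := @coord_continuous R (n + n + 1) (n + n + 1) i j.
rewrite (differentiable_linear_comp (@coord_linear i j) cc dO).2.
by rewrite J0_orbit_smooth.2 trmx_mul mulmxDr mulmxDl !mulmxA.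
Qed.

(** The upper left block is A J0 - J0 A = 2 A J0 since A anticommutes with [J0], and the upper right
    block is J0 u. Both determine X. *)
Lemma kblock_J0_m X : m_space X ->
  X *m kblock J0 + kblock J0 *m X^T = 0 -> X = 0.
Proof.
move=> /m_spaceP[A [u [[At AJ] ->]]].
rewrite /m_mx /kblock tr_block_mx At trmxK trmx0 !mulmx_block.
rewrite !(mulmx0, mul0mx, mulmx1, mul1mx, addr0, add0r) add_block_mx.
rewrite add0r -block_mx0 => /eq_block_mx[+ Ju _ _].
rewrite mulmxN -AJ -mulr2n -scaler_nat => /eqP.
rewrite scaler_eq0 pnatr_eq0/= => /eqP AJ0.
have -> : A = 0 by rewrite -[A]opprK -(mulmxJ0K A) AJ0 mul0mx oppr0.
have -> : u = 0 by rewrite -[u]opprK -(mulJ0K u) Ju mulmx0 oppr0.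
by rewrite trmx0.
Qed.

(** Uniqueness of the Lie bracket: a tangent vector is determined by its action on the entries of
    [J0_orbit]. *)
Lemma test_fun_separate g X Y : SO g -> m_space X -> m_space Y ->
  (forall i j, der (test_fun i j) g X = der (test_fun i j) g Y) -> X = Y.
Proof.
move=> SOg mX mY XY; apply/eqP; rewrite -subr_eq0; apply/eqP.
have mXY := mspaceB mX mY.
apply: kblock_J0_m => //.
have ug := SO_unit SOg.
have : g *m ((X - Y) *m kblock J0 + kblock J0 *m (X - Y)^T) *m g^T = 0.
  apply/matrixP => i j; rewrite -der_test_fun//; last exact: m_so21.
  rewrite derB//; try exact: m_so21.
    by rewrite XY subrr mxE.
  exact: fun_smooth (test_fun_invariant i j).
move=> /(congr1 (fun M => invmx g *m M *m invmx g^T)).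
by rewrite mulmx0 mul0mx !mulmxA mulVmx// mul1mx mulmxK ?unitmx_tr.
Qed.

Variable Gamma : set mat.
Hypothesis Gamma_SO : Gamma `<=` @SO R n.

Definition is_bracket x y z := vector_field Gamma z /\
  forall f, invariant_function [set 1%:M] f -> forall g, SO g ->
    der f g (z g) = der (fun h => der f h (y h)) g (x g)
                    - der (fun h => der f h (x h)) g (y g).

Lemma ebr_is_bracket x y : vector_field Gamma x -> vector_field Gamma y ->
  is_bracket x y (ebr x y).
Proof.
move=> vx vy; split=> [|f fi g SOg]; first exact: ebr_vf.
rewrite (der_comm_vf Gamma_SO (@real_separated_by_forms R) (fun_smooth fi) vx vy SOg).
have [w [wt wJ -> _]] := br_k_part (vf_m vx SOg) (vf_m vy SOg).
by rewrite (der_U_fun fi wt wJ (kblock_so21 wt) SOg) addr0.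
Qed.

Lemma lie_bracketE x y g : vector_field Gamma x -> vector_field Gamma y ->
  SO g -> lie_bracket Gamma x y g = ebr x y g.
Proof.
move=> vx vy SOg; have br_e := ebr_is_bracket vx vy.
(* As [ebr x y] is a witness, [xget] does not return its default value 0. *)
have [vl bl] : is_bracket x y (lie_bracket Gamma x y).
  by rewrite /lie_bracket; apply: xgetPex; exists (ebr x y).
apply: (@test_fun_separate g); first exact: SOg.
- exact: vf_m vl g SOg.
- exact: vf_m br_e.1 g SOg.
- by move=> i j; rewrite bl ?br_e.2//; exact: test_fun_invariant.
Qed.

(** The commutator formula with f = z: its [ebr] term is the derivative along the Lie bracket, which
    the curvature subtracts, and equivariance evaluates the remaining fibre term. *)
Lemma curvatureE x y z g : vector_field Gamma x -> vector_field Gamma y ->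
  vector_field Gamma z -> SO g ->
  curvature Gamma (@nabla R n) x y z g
  = - br (br (x g) (y g) - mproj (br (x g) (y g))) (z g).
Proof.
move=> vx vy vz SOg; rewrite /curvature {5}/nabla lie_bracketE//.
have := der_comm_vf Gamma_SO (@matrix_separated_by_forms R _ _) (vf_smooth vz)
  vx vy SOg.
have [w [wt wJ -> _]] := br_k_part (vf_m vx SOg) (vf_m vy SOg).
rewrite (der_U_vf vz wt wJ (kblock_so21 wt) SOg) /nabla => ->.
by rewrite addrC addrA addNr add0r.
Qed.

End LieBracket.

(** * The twistor space *)

Section TwistorSpace.
Variables (R : realType) (n : nat) (Gamma : set (mat R n)).
Hypothesis Gamma_SO : Gamma `<=` @SO R n.
Local Notation mat := (mat R n).
Implicit Types (X Y Z g h : mat) (x y z : mat -> mat).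

Definition twistor_acs : mat -> 'End(mat) := fun _ => linfun (@Jm R n).

Lemma twistor_acsE g X : twistor_acs g X = Jm X.
Proof. exact: lfunE. Qed.

Lemma twistor_acs_compatible : compatible_acs Gamma twistor_acs.
Proof.
split=> //.
- by move=> X _; exact: (smooth_cst (linfun (@Jm R n) X)).
- by move=> g X _ mX; rewrite twistor_acsE; exact: Jm_m.
- move=> g k X _ Uk _; have uk := U_unit Uk.
  by rewrite !twistor_acsE -Jm_conj// -!mulmxA mulVmx// mulmx1 mulKmx.
- by move=> g X _ mX; rewrite !twistor_acsE; exact: Jm_sq.
- by move=> g X Y _ mX mY; rewrite !twistor_acsE; exact: sigma_J.
- by move=> g X _ mX; rewrite twistor_acsE; exact: sigma_pos.
Qed.

Lemma app_twistor_vf x : vector_field Gamma x ->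
  vector_field Gamma (app twistor_acs x).
Proof.
move=> vx; have -> : app twistor_acs x = (fun g => Jm (x g)).
  by apply/funext => g; rewrite /app twistor_acsE.
apply: vf_linear vx; [exact: Jm_linear|exact: Jm_m|].
by move=> k X Uk; exact: Jm_conj.
Qed.

Lemma nabla_app_twistor x y g : vector_field Gamma x -> vector_field Gamma y ->
  SO g -> nabla x (app twistor_acs y) g = Jm (nabla x y g).
Proof.
move=> vx vy SOg; have -> : app twistor_acs y = (fun g => Jm (y g)).
  by apply/funext => h; rewrite /app twistor_acsE.
exact: (der_comp_linear (@Jm_linear R n) (@Jm_continuous R n) (vf_smooth vy) SOg
  (vf_so vx SOg)).
Qed.

(** Because [nabla] commutes with the almost complex structure, the derivative terms of the four
    brackets cancel and only the algebraic ones remain. *)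
Lemma nijenhuisE x y g : vector_field Gamma x -> vector_field Gamma y -> SO g ->
  nijenhuis Gamma twistor_acs x y g = - mproj (br (x g) (y g)).
Proof.
move=> vx vy SOg.
have [vJx vJy] := (app_twistor_vf vx, app_twistor_vf vy).
rewrite /nijenhuis !lie_bracketE// !twistor_acsE.
rewrite -(nijenhuis_alg (vf_m vx SOg) (vf_m vy SOg)); congr (_ *: _).
have [sx sy] := (vf_so vx SOg, vf_so vy SOg).
have JJ : Jm (Jm (nabla y x g)) = - nabla y x g
  /\ Jm (Jm (nabla x y g)) = - nabla x y g.
  by split; apply: Jm_sq; [exact: (der_m vx SOg sy)|exact: (der_m vy SOg sx)].
rewrite /ebr /torsion_bracket !nabla_app_twistor//.
have appE z : app twistor_acs z g = Jm (z g) by exact: twistor_acsE.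
rewrite !appE.
have JD X Z : Jm (X + Z) = Jm X + Jm Z by exact: linearD.
have JN X : Jm (- X) = - Jm X by exact: linearN.
move: (nabla (app _ x) y g) (nabla (app _ y) x g) => a b.
move: (nabla x y g) (nabla y x g) JJ => c d [JJd JJc].
move: (mproj _) (mproj _) (mproj _) (mproj _) => m1 m2 m3 m4.
rewrite !JD !JN JJd JJc.
by apply/matrixP => i j; rewrite !mxE; ring.
Qed.

Lemma sigmaE X Y : sigma X Y = \tr (J0 R n *m ursubmx X *m (ursubmx Y)^T)
  + \tr (J0 R n *m ulsubmx X *m ulsubmx Y).
Proof.
rewrite /sigma /mxtrace; congr (_ + _); apply: eq_bigr => i _.
by rewrite [RHS]mxE big_ord1 [_^T _ _]mxE.
Qed.

Lemma sigma_linearl Y : linear (fun X => sigma X Y : R).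
Proof.
move=> a X Z; rewrite !sigmaE ulsubmx_linear ursubmx_linear.
rewrite 2!mulmxDr 2!mulmxDl -!scalemxAr -!scalemxAl !linearD/= !linearZ/=.
by rewrite addrACA.
Qed.

Lemma sigma_linearr X : linear (fun Y => sigma X Y : R).
Proof.
move=> a Y Z; rewrite !sigmaE ulsubmx_linear ursubmx_linear.
rewrite [(_ + _)^T]linearP/= 2!mulmxDr -!scalemxAr !linearD/= !linearZ/=.
by rewrite addrACA.
Qed.

Lemma nabla_connection : connection Gamma (@nabla R n).
Proof.
split.
- exact: nabla_vf.
- move=> f x x' y fi vx vx' vy g SOg.
  exact: (der_linear _ (vf_smooth vy) SOg (vf_so vx SOg) (vf_so vx' SOg)).
- move=> x y y' vx vy vy' g SOg.
  exact: (derD (vf_smooth vy) (vf_smooth vy') SOg (vf_so vx SOg)).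
- move=> f x y fi vx vy g SOg.
  exact: (der_bilinear (@scale_linear R mat) (@scalel_linear R mat)
    (@scale_continuous _ _) (fun_smooth fi) (vf_smooth vy) SOg (vf_so vx SOg)).
Qed.

(** The metric has constant coefficients in the left trivialization, so its preservation is the
    product rule; the torsion is read off from [ebr]. *)
Lemma nabla_chern : chern_connection Gamma twistor_acs (@nabla R n).
Proof.
split; first exact: nabla_connection.
- move=> x y z vx vy vz g SOg.
  have Bl Y : linear (fun X : mat => sigma X (Jm Y)) by exact: sigma_linearl.
  have Br X : linear (fun Y : mat => sigma X (Jm Y)).
    by move=> a Y Z; rewrite Jm_linear sigma_linearr.
  have Bc : continuous (fun p : mat * mat => sigma p.1 (Jm p.2)).
    apply: (matrix_bilinear_continuous (B := fun X Y => sigma X (Jm Y))) => //.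
    by move=> X; exact: matrix_linear_continuous.
  rewrite /metric /omega !twistor_acsE.
  under eq_fun do rewrite twistor_acsE.
  exact: (der_bilinear Br Bl Bc (vf_smooth vy) (vf_smooth vz) SOg (vf_so vx SOg)).
- move=> x y vx vy g SOg; rewrite lie_bracketE// nijenhuisE// /ebr /torsion_bracket.
  by rewrite opprD addrA subrr sub0r.
Qed.

Lemma twistor_chern_ricci : is_chern_ricci Gamma twistor_acs
  (fun g X Y => (2 * n%:R - 4) * omega g X Y).
Proof.
exists (@nabla R n); first exact: nabla_chern.
move=> x y vx vy g SOg.
have [w [wt wJ wE trw]] := br_k_part (vf_m vx SOg) (vf_m vy SOg).
have Sl : linear (fun Z : mat => - Jm (br (kblock w) Z)).
  by move=> a X Y; rewrite br_linearr Jm_linear opprD scalerN.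
pose L : {linear mat -> mat} :=
  HB.pack (fun Z : mat => - Jm (br (kblock w) Z)) (GRing.isLinear.Build _ _ _ _ _ Sl).
have SE Z : linfun L Z = - Jm (br (kblock w) Z) by rewrite lfunE.
exists (linfun L).
  move=> z vz; rewrite SE curvatureE// wE twistor_acsE.
  by rewrite linearN.
have -> : (2 * n%:R - 4) * omega g (x g) (y g)
    = optrace (fun E => linfun L (mproj E)).
  under eq_fun do rewrite SE.
  (* The constant is (n - 2) from the trace over m times 2 from [br_k_part]. *)
  rewrite optrace_curvature// trw /omega; ring.
apply: trace_m_exists => X mX; rewrite SE -scaleN1r.
by apply/mspaceZ/Jm_m/br_kblock_m.
Qed.

End TwistorSpace.

Theorem theorem4 (R : realType) (n : nat) (Gamma : set 'M[R]_(n + n + 1)) :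
  (0 < n)%N -> torsion_free_discrete_subgroup Gamma ->
  exists J : 'M[R]_(n + n + 1) -> 'End('M[R]_(n + n + 1)),
    compatible_acs Gamma J /\
    is_chern_ricci Gamma J
      (fun g X Y => (2 * n%:R - 4) * omega g X Y).
Proof.
move=> _ /Gamma_sub Gamma_SO; exists (@twistor_acs R n); split.
  exact: twistor_acs_compatible.
exact: twistor_chern_ricci.
Qed.
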